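(* Let $N\ge 1$, $s\in(0,1)$, $p>1$, let $D\subset \mathbb{R}^N$ be an open set, $q\in L^{\infty}(D)$ with $q\geq0$, $g\in L^{p'}(D)$ where $p'=\frac{p}{p-1}$, and let $v,w\in \tilde{W}^{s,p}(D)$ be such that $v$ is a supersolution and $w$ is a subsolution of $$(-\Delta)^s_p u+q(x)|u|^{p-2}u=g\quad\text{in } D,$$ with $v\geq w$ a.e. in $\mathbb{R}^N$. Suppose that one of the following holds: (1) $\frac{1}{1-s}<p\leq2$ and ($v\in L^{\infty}(\mathbb{R}^N)$ or $w\in L^{\infty}(\mathbb{R}^N)$); or (2) $p\geq 2$ and for some $\alpha\in(0,1]$ with $\alpha(p-2)>sp-1$ we have $v\in C_{loc}^{\alpha}(D)\cap L^{\infty}(\mathbb{R}^N)$ or $w\in C^{\alpha}_{loc}(D)\cap L^{\infty}(\mathbb{R}^N)$. Then either $v=w$ a.e. in $\mathbb{R}^N$, or $$\operatorname{ess\,inf}_{K}\,(v-w)>0\quad\text{for all } K\subset\subset D.$$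
   Context: $W^{s,p}(\mathbb{R}^N)$ is the set of $u\in L^p(\mathbb{R}^N)$ with $\int_{\mathbb{R}^N}\int_{\mathbb{R}^N}\frac{|u(x)-u(y)|^p}{|x-y|^{N+sp}}\,dx\,dy<\infty$. For an open set $D\subset\mathbb{R}^N$, $\mathcal{W}^{s,p}_0(D):=\{u\in W^{s,p}(\mathbb{R}^N): u= 0 \text{ a.e. on } \mathbb{R}^N\setminus D\}$ and $\tilde W^{s,p}(D):=\{u\in L^p_{loc}(\mathbb{R}^N): \int_D\int_{\mathbb{R}^N}\frac{|u(x)-u(y)|^p}{|x-y|^{N+sp}}\,dx\,dy<\infty\}$. A function $v\in\tilde W^{s,p}(D)$ is a supersolution of $(-\Delta)^s_pu+q(x)|u|^{p-2}u=g$ in $D$ if for all nonnegative $\varphi\in\mathcal{W}^{s,p}_0(D)$ with compact support in $\mathbb{R}^N$, $$\int_{\mathbb{R}^N}\int_{\mathbb{R}^N}\frac{|v(x)-v(y)|^{p-2}(v(x)-v(y))(\varphi(x)-\varphi(y))}{|x-y|^{N+sp}}\,dx\,dy+\int_D q|v|^{p-2}v\,\varphi\,dx\ge\int_D g\varphi\,dx .$$ It is a subsolution if it satisfies the same condition with $\ge$ replaced by $\le$. (Here $|a|^{p-2}a:=0$ for $a=0$.) $K\subset\subset D$ means that $\overline K$ is compact and contained in $D$. $C^\alpha_{loc}(D)$ denotes the functions that are Hölder continuous with exponent $\alpha$ (Lipschitz if $\alpha=1$) on every compact subset of $D$. *)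

(* Defs.v *)
From HB Require Import structures.
From mathcomp Require Import all_boot all_order all_algebra.
From mathcomp Require Import all_classical all_reals all_analysis.
From mathcomp Require Import measurable_realfun ess_sup_inf.

Set Implicit Arguments.
Unset Strict Implicit.
Unset Printing Implicit Defensive.

Import Order.TTheory GRing.Theory Num.Theory.
Import numFieldNormedType.Exports.

Local Open Scope classical_set_scope.
Local Open Scope ring_scope.

(* The sigma-algebra on R^N is generated by the coordinates; it is the Borel
   one (rV_measurableE below). *)
Definition rV_display : measure_display -> measure_display.
Proof. exact. Qed.

Section rV_measurable.
Context (R : realType) (N : nat).

Definition rV_coord_sets : set (set 'rV[R]_N) :=
  [set A | exists i : 'I_N, exists2 B : set R, measurable B &
    A = (fun x : 'rV[R]_N => x 0 i) @^-1` B].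

Definition rV_measurable : set (set 'rV[R]_N) := <<s rV_coord_sets >>.

Let rV_measurable0 : rV_measurable set0.
Proof. exact: sigma_algebra0. Qed.

Let rV_measurableC A : rV_measurable A -> rV_measurable (~` A).
Proof. exact: sigma_algebraC. Qed.

Let rV_measurable_bigcup (F : (set 'rV[R]_N)^nat) :
  (forall i, rV_measurable (F i)) -> rV_measurable (\bigcup_i F i).
Proof. exact: sigma_algebra_bigcup. Qed.

HB.instance Definition _ := @isMeasurable.Build (rV_display default_measure_display)
  'rV[R]_N rV_measurable rV_measurable0 rV_measurableC rV_measurable_bigcup.

Lemma measurable_coord (i : 'I_N) :
  measurable_fun [set: 'rV[R]_N] (fun x : 'rV[R]_N => x 0 i).
Proof.
by move=> _ B mB; rewrite setTI; apply: sub_gen_smallest; exists i, B.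
Qed.

Lemma measurable_fun_rV d (T : measurableType d) (A : set T) (f : T -> 'rV[R]_N) :
  (forall i, measurable_fun A (fun t => f t 0 i)) -> measurable_fun A f.
Proof.
move=> mf mA; apply: (@measurability _ _ _ _ _ _ rV_coord_sets) => //.
move=> _ [_ [i [B mB ->]] <-]; exact: mf.
Qed.

Lemma measurable_open_rV (U : set 'rV[R]_N) : open U -> measurable U.
Proof.
move=> oU.
pose box (ab : 'rV[rat]_N * 'rV[rat]_N) : set 'rV[R]_N :=
  [set x | forall i, ratr (ab.1 0 i) < x 0 i < ratr (ab.2 0 i)].
have mbox ab : measurable (box ab).
  have -> : box ab = \bigcap_(i in [set: 'I_N])
      ((fun x : 'rV[R]_N => x 0 i) @^-1`
        `]ratr (ab.1 0 i), ratr (ab.2 0 i)[%classic).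
    apply/seteqP; split => x /= xab i; first by move=> _ /=; rewrite in_itv/=.
    by have := xab i Logic.I; rewrite /= in_itv.
  apply: fin_bigcap_measurable => // i _; rewrite -[X in measurable X]setTI.
  exact: measurable_coord.
have -> : U = \bigcup_ab (if pselect (box ab `<=` U) then box ab else set0).
  apply/seteqP; split => [x Ux|x [ab _]]; last by case: pselect => // /[apply].
  have /nbhs_ballP [e /= e0 eU] : nbhs x U by exact: open_nbhs_nbhs.
  have /choice [a aP] : forall i, exists a : rat, x 0 i - e < ratr a < x 0 i.
    move=> i; have /rat_in_itvoo [r] : x 0 i - e < x 0 i by rewrite gtrBl.
    by rewrite in_itv; exists r.
  have /choice [b bP] : forall i, exists b : rat, x 0 i < ratr b < x 0 i + e.
    move=> i; have /rat_in_itvoo [r] : x 0 i < x 0 i + e by rewrite ltrDl.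
    by rewrite in_itv; exists r.
  exists (\row_i a i, \row_i b i) => //; case: pselect => [_|[]] /=.
    by move=> i; rewrite !mxE; have /andP[_ ->] := aP i; have /andP[-> _] := bP i.
  move=> y yab; apply: eU; split=> // k i; rewrite (ord1 k).
  have := yab i; rewrite !mxE => /andP[ay yb]; rewrite /ball/= ltr_distlC.
  have /andP[xa _] := aP i; have /andP[_ bx] := bP i.
  by rewrite (lt_trans xa ay) (lt_trans yb bx).
apply: countable_bigcupT_measurable => // ab.
by case: pselect => ? /=; [exact: mbox|exact: measurable0].
Qed.

Lemma rV_measurableE : @measurable _ 'rV[R]_N = <<s @open 'rV[R]_N >>.
Proof.
apply/seteqP; split; last first.
  apply: smallest_sub => [|U]; first exact: sigma_algebra_measurable.
  exact: measurable_open_rV.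
apply: smallest_sub; first exact: smallest_sigma_algebra.
move=> _ [i [B mB ->]].
have mBorel : @measurable _ R `<=` [set B | <<s @open 'rV[R]_N >>
    ((fun x : 'rV[R]_N => x 0 i) @^-1` B)].
  rewrite (RGenOpens.measurableE R : @measurable _ R = _); apply: smallest_sub.
    split => [|C|F] /=.
    - by rewrite preimage_set0; exact: sigma_algebra0.
    - by rewrite setTD -preimage_setC; exact: sigma_algebraC.
    - by rewrite preimage_bigcup; exact: sigma_algebra_bigcup.
  move=> C [a [b ->]] /=; apply: sub_gen_smallest.
  apply: open_comp => [x _|]; [exact: coord_continuous|exact: itv_open].
exact: mBorel.
Qed.

End rV_measurable.

Section rV_cons.
Context (R : realType).

Definition rV_cons (n : nat) (z : R * 'rV[R]_n) : 'rV[R]_n.+1 :=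
  \row_i oapp (fun j => z.2 0 j) z.1 (unlift ord0 i).

Definition rV_uncons (n : nat) (x : 'rV[R]_n.+1) : R * 'rV[R]_n :=
  (x 0 ord0, \row_i x 0 (lift ord0 i)).

Lemma rV_consK n : cancel (@rV_cons n) (@rV_uncons n).
Proof.
move=> [t y]; rewrite /rV_uncons /rV_cons /=; congr pair.
  by rewrite mxE unlift_none.
by apply/rowP => i; rewrite !mxE liftK.
Qed.

Lemma measurable_rV_cons n : measurable_fun setT (@rV_cons n).
Proof.
apply: measurable_fun_rV => i; rewrite /rV_cons.
case: (unliftP ord0 i) => [j ->|->].
  apply: (eq_measurable_fun ((fun y : 'rV[R]_n => y 0 j) \o snd)).
    by move=> z _ /=; rewrite mxE liftK.
  by apply: measurableT_comp => //; exact: measurable_coord.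
apply: (eq_measurable_fun fst) => // z _ /=.
by rewrite mxE unlift_none.
Qed.

Lemma measurable_rV_uncons n : measurable_fun setT (@rV_uncons n).
Proof.
apply/measurable_fun_pairP; split => /=; first exact: measurable_coord.
apply: measurable_fun_rV => i.
apply: (eq_measurable_fun (fun x : 'rV[R]_n.+1 => x 0 (lift ord0 i))).
  by move=> x _ /=; rewrite mxE.
exact: measurable_coord.
Qed.

End rV_cons.

(* Lebesgue measure on R^(n+1) = R x R^n is the product measure *)
Section rV_lebesgue_step.
Context (R : realType) (n : nat).
Variable mu : {sigma_finite_measure set 'rV[R]_n -> \bar R}.

Local Notation mu1 := (@lebesgue_measure R \x mu)%E.

Definition rV_lebesgue_step : set 'rV[R]_n.+1 -> \bar R :=
  pushforward mu1 (@rV_cons R n).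

Let step0 : rV_lebesgue_step set0 = 0%E.
Proof. by rewrite /rV_lebesgue_step /pushforward preimage_set0 measure0. Qed.

Let step_ge0 A : (0 <= rV_lebesgue_step A)%E.
Proof. exact: integral_ge0. Qed.

Let step_sigma_additive : semi_sigma_additive rV_lebesgue_step.
Proof.
have mcons F : measurable F -> measurable (@rV_cons R n @^-1` F).
  by move=> mF; rewrite -[X in measurable X]setTI; exact: measurable_rV_cons.
move=> F mF tF mUF; rewrite /rV_lebesgue_step /pushforward preimage_bigcup.
apply: measure_semi_sigma_additive.
- by move=> k; exact: mcons.
- apply/trivIsetP => /= i j _ _ ij; rewrite -preimage_setI.
  by move/trivIsetP : tF => /(_ _ _ _ _ ij) -> //; rewrite preimage_set0.
- by rewrite -preimage_bigcup; exact: mcons.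
Qed.

HB.instance Definition _ := isMeasure.Build _ _ _ rV_lebesgue_step
  step0 step_ge0 step_sigma_additive.

Let step_sigma_finite : sigma_finite setT rV_lebesgue_step.
Proof.
have /sigma_finiteP[F [TF ndF Foo]] := sigma_finiteT (@lebesgue_measure R).
have /sigma_finiteP[G [TG ndG Goo]] := sigma_finiteT mu.
exists (fun k => @rV_uncons R n @^-1` (F k `*` G k)).
  apply/seteqP; split => // x _.
  have [i _ Fi] : (\bigcup_k F k) (rV_uncons x).1 by rewrite -TF.
  have [j _ Gj] : (\bigcup_k G k) (rV_uncons x).2 by rewrite -TG.
  exists (maxn i j) => //; split.
  - by move: Fi; exact/subsetPset/ndF/leq_maxl.
  - by move: Gj; exact/subsetPset/ndG/leq_maxr.
move=> k; have [mF F_oo] := Foo k; have [mG G_oo] := Goo k; split.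
  rewrite -[X in measurable X]setTI.
  by apply: measurable_rV_uncons => //; exact: measurableX.
rewrite /rV_lebesgue_step /pushforward.
have -> : @rV_cons R n @^-1` (@rV_uncons R n @^-1` (F k `*` G k)) = F k `*` G k.
  by apply/funext => z; rewrite /preimage /mkset rV_consK.
by rewrite product_measure1E// lte_mul_pinfty// ge0_fin_numE.
Qed.

HB.instance Definition _ := Measure_isSigmaFinite.Build _ _ _
  rV_lebesgue_step step_sigma_finite.

End rV_lebesgue_step.

Fixpoint rV_lebesgue (R : realType) (N : nat) :
    {sigma_finite_measure set 'rV[R]_N -> \bar R} :=
  if N is n.+1 then rV_lebesgue_step (rV_lebesgue R n) else \d_(0 : 'rV[R]_0).

Lemma rV_lebesgue_box (R : realType) (N : nat) (B : 'I_N -> set R) :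
  (forall i, measurable (B i)) ->
  rV_lebesgue R N [set x | forall i, B i (x 0 i)] =
    (\prod_(i < N) @lebesgue_measure R (B i))%E.
Proof.
elim: N B => [|n IHn] B mB /=.
  by rewrite big_ord0 diracE mem_set // => -[].
rewrite big_ord_recl -(IHn (fun i => B (lift ord0 i))) //.
rewrite /rV_lebesgue_step /pushforward.
rewrite -(@product_measure1E _ _ _ _ _ lebesgue_measure (rV_lebesgue R n)) //.
  congr product_measure1; apply/seteqP; split => -[t y] /=.
    move=> tyB; split; first by have := tyB ord0; rewrite mxE unlift_none.
    by move=> i; have := tyB (lift ord0 i); rewrite mxE liftK.
  move=> [Bt By] i; rewrite mxE.
  by case: (unliftP ord0 i) => [j ->|->]; rewrite ?liftK ?unlift_none.
  exact: mB.
rewrite [X in measurable X](_ : _ = \bigcap_(i in [set: 'I_n])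
    ((fun x : 'rV[R]_n => x 0 i) @^-1` B (lift ord0 i))); last first.
  by apply/seteqP; split => x /= xB i => [_|]; apply: xB.
apply: fin_bigcap_measurable => // i _; rewrite -[X in measurable X]setTI.
exact: measurable_coord.
Qed.

Section function_spaces.
Context (R : realType) (N : nat).
Local Notation rV := 'rV[R]_N.
Local Notation mu := (rV_lebesgue R N).
Implicit Types (A D K : set rV) (s p alpha : R) (u v q g phi : rV -> R).

(* Euclidean norm; the norm `|x| of the library is the sup norm *)
Definition enorm (x : rV) : R := Num.sqrt (\sum_(i < N) x 0 i ^+ 2).

Definition Lp_on A (r : \bar R) : set (rV -> R) := [set u | u \_ A \in Lfun mu r].

Definition Lp_loc (r : \bar R) : set (rV -> R) :=
  [set u | forall K, compact K -> Lp_on K r u].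

Definition nl_kernel s p (z : rV * rV) : R :=
  enorm (z.1 - z.2) `^ (N%:R + s * p).

Definition nl_energy s p A u : \bar R :=
  (\int[mu \x mu]_(z in A `*` setT)
    (`|u z.1 - u z.2| `^ p / nl_kernel s p z)%:E)%E.

Definition fracW s p : set (rV -> R) :=
  [set u | Lp_on setT p%:E u /\ (nl_energy s p setT u < +oo)%E].

Definition fracW0 s p D : set (rV -> R) :=
  [set u | fracW s p u /\ {ae mu, forall x, ~ D x -> u x = 0}].

Definition fracWtilde s p D : set (rV -> R) :=
  [set u | Lp_loc p%:E u /\ (nl_energy s p D u < +oo)%E].

(* |a|^(p-2) a; it is 0 at a = 0 whatever p *)
Definition signed_pow p (a : R) : R := `|a| `^ (p - 2) * a.

Definition weak_form s p D q v phi : \bar R :=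
  (\int[mu \x mu]_z (signed_pow p (v z.1 - v z.2) * (phi z.1 - phi z.2)
      / nl_kernel s p z)%:E
   + \int[mu]_(x in D) (q x * signed_pow p (v x) * phi x)%:E)%E.

(* phi is an a.e.-class: its sign and its support are taken up to null sets *)
Definition test_function s p D : set (rV -> R) :=
  [set phi | [/\ fracW0 s p D phi,
    {ae mu, forall x, 0 <= phi x} &
    exists2 K, compact K & {ae mu, forall x, ~ K x -> phi x = 0}]].

Definition supersolution s p D q g v : Prop :=
  fracWtilde s p D v /\
  forall phi, test_function s p D phi ->
    (\int[mu]_(x in D) (g x * phi x)%:E <= weak_form s p D q v phi)%E.

Definition subsolution s p D q g v : Prop :=
  fracWtilde s p D v /\
  forall phi, test_function s p D phi ->
    (weak_form s p D q v phi <= \int[mu]_(x in D) (g x * phi x)%:E)%E.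

(* membership of an a.e.-class: some representative on D is locally Hoelder *)
Definition holder_loc alpha D : set (rV -> R) :=
  [set u | exists2 f : rV -> R, {ae mu, forall x, D x -> u x = f x} &
    forall K, compact K -> K `<=` D ->
      exists C : R, forall x y, K x -> K y ->
        `|f x - f y| <= C * enorm (x - y) `^ alpha].

Definition compactly_contained K D : Prop :=
  compact (closure K) /\ closure K `<=` D.

Definition ess_inf_on K u : \bar R :=
  ess_inf mu (patch (cst +oo%E) K (EFin \o u)).

End function_spaces.

(* Main.v *)
Require Import Defs.
From HB Require Import structures.
From mathcomp Require Import all_boot all_order all_algebra.
From mathcomp Require Import all_classical all_reals all_analysis.
From mathcomp Require Import measurable_realfun ess_sup_inf ring lra.
Set Implicit Arguments.
Unset Strict Implicit.
Unset Printing Implicit Defensive.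
Import Order.TTheory GRing.Theory Num.Theory.
Import numFieldNormedType.Exports.
Local Open Scope classical_set_scope.
Local Open Scope ring_scope.

(** Write h(t) = |t|^(p-2) t, k(x,y) = |x-y|^-(N+sp) and u = v - w, and suppose
    that u >= 0 is not a.e. zero.  Around a point x0 of D, away from x0 there is
    a bounded set M of positive measure on which u >= 4e for some e > 0.  The
    barrier
      W = w + a f + 4e 1_M,   f a tent of height 1 supported near x0,
    stays below v outside the support of f.  Nonlocality makes W a strict
    subsolution near x0 once a is small: for x near x0 and y in M the increment
    W(x) - W(y) is smaller than w(x) - w(y) by at least 2e, which lowers the
    operator at x by an amount independent of a (signed_pow_gap), whereas the
    tent costs at most a multiple of
      a^th * integral of min(|x-y|^g, 1) |x-y|^-(N+sp) dy,
    which is finite when g > sp (integral_trunc_kernel).  This is where the two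
    alternatives of the theorem enter: h is (p-1)-Hoelder when p <= 2, which
    gives g = p - 1; when p >= 2, h is Lipschitz with constant of order m^(p-2)
    on [-m, m], and the Hoelder bound on w near the diagonal gives
    g = al (p-2) + 1 (regular_growth).

    Testing with phi = (W - v)^+ = (a f - u)^+ gives phi = 0: the weak inequalities
    for v and w are subtracted (ordered_forms), and
      (h(v(x)-v(y)) - h(w(x)-w(y))) (phi(x)-phi(y)) k(x,y)
    is bounded pointwise by splitting it at h(W(x)-W(y)).  The part containing
    v and W is nonpositive because h is monotone, and the part containing W and w
    is bounded by G(x,y) phi(x) + G(y,x) phi(y) with an explicit G
    (comparison_integrand_le, barrier_increment).  Only the integral of G has to
    be computed; the weak form of W never appears.  For small a the result is
    0 <= (negative constant) * (integral of phi), hence u >= a f near x0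
    (strong_comparison_ball), and a finite cover of the compact set concludes.

    The subtracted inequality is unchanged when (v, w) is replaced by (-w, -v),
    so it is enough to treat the case where the regularity hypothesis is on w. *)

(** * Elementary inequalities for powers *)

Section powers.
Context {R : realType}.
Implicit Types (a b d e k q t x y : R).

(** For z <= s and q <= 1 one has (z/s)^q >= z/s; adding this for z = x and z = y,
    with s = x + y, gives the inequality. *)
Lemma powR_subadd q x y : 0 < q -> q <= 1 -> 0 <= x -> 0 <= y ->
  (x + y) `^ q <= x `^ q + y `^ q.
Proof.
move=> q0 q1 x0 y0; have [s0|s0] := eqVneq (x + y) 0.
  by rewrite s0 powR0 ?gt_eqF// addr_ge0 ?powR_ge0.
have sp : 0 < x + y by rewrite lt_neqAle eq_sym s0 addr_ge0.
have frac z : 0 <= z -> z <= x + y -> z / (x + y) * (x + y) `^ q <= z `^ q.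
  rewrite le_eqVlt => /predU1P[<- _|z0 zs]; first by rewrite !mul0r powR_ge0.
  rewrite -{2}(divfK s0 z) powRM ?divr_ge0 ?(ltW z0) ?(ltW sp)//.
  apply: ler_wpM2r; first exact: powR_ge0.
  by apply: ger1_powR => //; rewrite divr_gt0//= ler_pdivrMr// mul1r.
have -> : (x + y) `^ q = x / (x + y) * (x + y) `^ q + y / (x + y) * (x + y) `^ q.
  by rewrite -mulrDl -mulrDl divff// mul1r.
by apply: lerD; apply: frac; rewrite // ?lerDl ?lerDr.
Qed.

Lemma powR_subB q x y : 0 < q -> q <= 1 -> 0 <= y -> y <= x ->
  x `^ q - y `^ q <= (x - y) `^ q.
Proof.
move=> q0 q1 y0 yx; rewrite lerBlDr -{1}(subrK y x).
by apply: powR_subadd; rewrite ?subr_ge0.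
Qed.

(** With t = y/x this is 1 - t^q <= n (1 - t), which follows from Bernoulli's
    inequality for the integer exponent n because t^n <= t^q. *)
Lemma powR_lipschitz q (n : nat) x y : 1 <= q -> q <= n%:R -> 0 <= y -> y <= x ->
  x `^ q - y `^ q <= n%:R * x `^ (q - 1) * (x - y).
Proof.
move=> q1 qn y0 yx.
have q0 : 0 < q by rewrite (lt_le_trans _ q1).
have [x0|x0] := eqVneq x 0.
  have -> : y = 0 by apply/eqP; rewrite eq_le y0 -x0 yx.
  by rewrite x0 !subrr mulr0.
have xp : 0 < x by rewrite lt_neqAle eq_sym x0 (le_trans y0).
set t := y / x.
have t0 : 0 <= t by rewrite divr_ge0// ltW.
have t1 : t <= 1 by rewrite ler_pdivrMr// mul1r.
have -> : y = t * x by rewrite divfK.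
rewrite powRM ?(ltW xp)// -(mulr_powRB1 (ltW xp) q0).
have -> : x * x `^ (q - 1) - t `^ q * (x * x `^ (q - 1)) =
  (x `^ (q - 1) * x) * (1 - t `^ q) by ring.
have -> : n%:R * x `^ (q - 1) * (x - t * x) =
  (x `^ (q - 1) * x) * (n%:R * (1 - t)) by ring.
apply: ler_wpM2l; first by rewrite mulr_ge0 ?powR_ge0 ?ltW.
apply: (@le_trans _ _ (1 - t ^+ n)).
  rewrite lerD2l lerN2 -powR_mulrn//.
  have [->|tn0] := eqVneq t 0.
    by rewrite !powR0// gt_eqF// (lt_le_trans _ qn).
  by apply: ger_powR => //; rewrite t1 andbT lt_neqAle eq_sym tn0.
rewrite -[X in X - _](expr1n _ n) subrXX mulrC.
apply: ler_wpM2r; first by rewrite subr_ge0.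
rewrite -[X in _ <= X%:R]card_ord -sumr_const; apply: ler_sum => i _.
by rewrite expr1n mul1r exprn_ile1.
Qed.

End powers.

Section signed_power.
Context {R : realType}.
Variable p : R.
Hypothesis p1 : 1 < p.
Implicit Types (a b d e k q t x y : R).
Local Notation h := (signed_pow p).

Let q0 : 0 < p - 1. Proof. by rewrite subr_gt0. Qed.

Lemma signed_powN a : h (- a) = - h a.
Proof. by rewrite /signed_pow normrN mulrN. Qed.

Lemma signed_pow_ge0E a : 0 <= a -> h a = a `^ (p - 1).
Proof.
move=> a0; rewrite /signed_pow ger0_norm// -(mulr_powRB1 a0 q0) mulrC.
by congr (_ * _ `^ _); lra.
Qed.

Lemma signed_pow_le0E a : a <= 0 -> h a = - (- a) `^ (p - 1).
Proof. by move=> a0; rewrite -{1}(opprK a) signed_powN signed_pow_ge0E// oppr_ge0. Qed.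

Lemma norm_signed_pow a : `|h a| = `|a| `^ (p - 1).
Proof.
have [a0|/ltW a0] := leP 0 a.
  by rewrite signed_pow_ge0E// ger0_norm ?powR_ge0// ger0_norm.
by rewrite signed_pow_le0E// normrN ger0_norm ?powR_ge0// ler0_norm.
Qed.

Lemma le_signed_pow x y : x <= y -> h x <= h y.
Proof.
move=> xy; have [x0|/ltW x0] := leP 0 x.
  have y0 := le_trans x0 xy.
  by rewrite !signed_pow_ge0E// ge0_ler_powR ?nnegrE// ltW.
have [y0|/ltW y0] := leP 0 y.
  rewrite signed_pow_le0E// signed_pow_ge0E//.
  by rewrite (le_trans _ (powR_ge0 _ _))// oppr_le0 powR_ge0.
by rewrite !signed_pow_le0E// lerN2 ge0_ler_powR ?nnegrE ?oppr_ge0 ?lerN2// ltW.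
Qed.

(** For x and y of the same sign this is subadditivity of the power; for opposite signs
    |h x - h y| = |x|^(p-1) + |y|^(p-1), and both terms are at most |x-y|^(p-1). *)
Lemma signed_pow_le2 x y : p <= 2 -> `|h x - h y| <= 2 * `|x - y| `^ (p - 1).
Proof.
move=> p2.
wlog yx : x y / y <= x.
  move=> H; have [|/ltW] := leP y x; first exact: H.
  by move=> /H; rewrite distrC (distrC y).
rewrite !ger0_norm ?subr_ge0 ?le_signed_pow//.
have pq : p - 1 <= 1 by lra.
have dbl a : 0 <= a -> a <= 2 * a by lra.
have [y0|/ltW y0] := leP 0 y.
  rewrite !signed_pow_ge0E ?(le_trans y0 yx)//.
  by apply: (le_trans (powR_subB q0 pq y0 yx)); rewrite dbl// powR_ge0.
have [x0|/ltW x0] := leP 0 x.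
  rewrite signed_pow_ge0E// signed_pow_le0E// opprK mulr2n mulrDl mul1r.
  by apply: lerD; apply: ge0_ler_powR; rewrite ?nnegrE ?(ltW q0)//; lra.
rewrite !signed_pow_le0E// opprK addrC.
have -> : x - y = - y - - x by lra.
apply: (@le_trans _ _ ((- y - - x) `^ (p - 1))); last by rewrite dbl// powR_ge0.
by apply: powR_subB; rewrite ?oppr_ge0 ?lerN2.
Qed.

(** The natural number n stands for p - 1 rounded up; the Lipschitz constant of h on
    [-m, m] is (p-1) m^(p-2).  For opposite signs compare both values with h 0 = 0. *)
Lemma signed_pow_ge2 (n : nat) m x y : 2 <= p -> p - 1 <= n%:R ->
  `|x| <= m -> `|y| <= m ->
  `|h x - h y| <= n%:R * m `^ (p - 2) * `|x - y|.
Proof.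
move=> p2 pn xm ym.
wlog yx : x y xm ym / y <= x.
  move=> H; have [|/ltW] := leP y x; first exact: H.
  by move=> /(H _ _ ym xm); rewrite distrC (distrC y).
rewrite !ger0_norm ?subr_ge0 ?le_signed_pow//.
have n1 : 1 <= n%:R :> R by lra.
have pE : p - 1 - 1 = p - 2 by lra.
have main z z' : 0 <= z' -> z' <= z -> z <= m ->
    z `^ (p - 1) - z' `^ (p - 1) <= n%:R * m `^ (p - 2) * (z - z').
  move=> z'0 zz' zm; have z0 := le_trans z'0 zz'.
  have q1 : 1 <= p - 1 by lra.
  apply: (le_trans (powR_lipschitz q1 pn z'0 zz')); rewrite pE.
  apply: ler_wpM2r; first by rewrite subr_ge0.
  apply: ler_wpM2l; first by rewrite (le_trans _ n1).
  by rewrite ge0_ler_powR ?nnegrE// ?subr_ge0// (le_trans z0).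
have [y0|/ltW y0] := leP 0 y.
  rewrite !signed_pow_ge0E ?(le_trans y0 yx)//.
  by apply: main => //; rewrite (le_trans (ler_norm _)).
have [x0|/ltW x0] := leP 0 x.
  rewrite signed_pow_ge0E// signed_pow_le0E// opprK.
  have := main x 0 (lexx _) x0 (le_trans (ler_norm _) xm).
  have ny0 : 0 <= - y by rewrite oppr_ge0.
  have ym' : - y <= m by rewrite -normrN in ym; exact: le_trans (ler_norm _) ym.
  have := main (- y) 0 (lexx _) ny0 ym'.
  rewrite powR0 ?gt_eqF// !subr0 => A B.
  by rewrite mulrDr lerD.
rewrite !signed_pow_le0E// opprK addrC.
have -> : x - y = - y - - x by lra.
rewrite -normrN in ym.
by apply: main; rewrite ?oppr_ge0 ?lerN2// (le_trans (ler_norm _) ym).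
Qed.

(** One of the two halves of [t - 2e, t] lies on one side of the origin, so the
    increment of h is at least (z+e)^q - z^q for some 0 <= z <= L + e, where q = p - 1.
    Writing this as (z+e)^q (1 - (z/(z+e))^q) and using that z/(z+e) increases
    with z gives a lower bound that is positive for every q > 0. *)
Lemma signed_pow_gap (e L : R) : 0 < e -> 0 <= L ->
  exists2 c, 0 < c & forall t, `|t| <= L -> c <= h t - h (t - (e + e)).
Proof.
have one : 1 `^ (p - 1) = 1 :> R by rewrite powR1.
move=> e0 L0; exists (e `^ (p - 1) * (1 - ((L + e) / (L + e + e)) `^ (p - 1))).
  apply: mulr_gt0; first exact: powR_gt0.
  rewrite subr_gt0 -[X in _ < X]one.
  apply: gt0_ltr_powR => //; rewrite ?nnegrE ?divr_ge0 ?addr_ge0 ?(ltW e0)//.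
  by rewrite ltr_pdivrMr ?mul1r; lra.
have pos x : 0 <= x -> x <= L + e ->
    e `^ (p - 1) * (1 - ((L + e) / (L + e + e)) `^ (p - 1)) <=
    (x + e) `^ (p - 1) - x `^ (p - 1).
  move=> x0 xL; have xe : 0 < x + e by lra.
  have -> : x `^ (p - 1) = (x + e) `^ (p - 1) * (x / (x + e)) `^ (p - 1).
    rewrite -powRM ?divr_ge0 ?(ltW xe)//; congr (_ `^ _).
    by field; rewrite gt_eqF.
  rewrite -[X in _ <= X - _]mulr1 -mulrBr.
  have xe0 : 0 <= x / (x + e) by rewrite divr_ge0// ltW.
  have Le : 0 < L + e + e by lra.
  have Le0 : 0 <= (L + e) / (L + e + e) by rewrite divr_ge0 ?(ltW Le)//; lra.
  have Le1 : (L + e) / (L + e + e) <= 1 by rewrite ler_pdivrMr// mul1r; lra.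
  have xeL : x / (x + e) <= (L + e) / (L + e + e).
    by rewrite ler_pdivrMr// mulrAC ler_pdivlMr//; nra.
  have mono := ge0_ler_powR (ltW q0).
  apply: ler_pM; first exact: powR_ge0.
  - by rewrite subr_ge0 -[X in _ <= X]one; apply: mono; rewrite ?nnegrE.
  - by apply: mono; rewrite ?nnegrE ?(ltW e0) ?(ltW xe)// lerDr.
  - by rewrite lerD2l lerN2; apply: mono; rewrite ?nnegrE.
move=> t; rewrite ler_norml => /andP[t1 t2].
(* the half of [t - 2e, t] on the side of the origin where t - e lies is used *)
have [te|/ltW te] := leP 0 (t - e).
  apply: (@le_trans _ _ (h t - h (t - e))); last first.
    by rewrite lerD2l lerN2 le_signed_pow//; lra.
  rewrite !signed_pow_ge0E//; last lra.
  by have := pos _ te; rewrite subrK; apply; lra.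
apply: (@le_trans _ _ (h (t - e) - h (t - (e + e)))); last first.
  by rewrite lerD2r le_signed_pow//; lra.
rewrite !signed_pow_le0E ?opprK; [|lra..].
have te0 : 0 <= - (t - e) by lra.
have teL : - (t - e) <= L + e by lra.
have := pos _ te0 teL; have -> : - (t - e) + e = - (t - (e + e)) by lra.
by move=> /le_trans; apply; rewrite addrC.
Qed.

(** The larger of |a| and |b| bounds both factors.  This takes the place of
    Young's inequality in the integrability proofs. *)
Lemma signed_pow_young a b : `|h a * b| <= `|a| `^ p + `|b| `^ p.
Proof.
rewrite normrM norm_signed_pow.
have pp : 0 < p := lt_trans ltr01 p1.
have [ab|/ltW ba] := leP `|b| `|a|.
  apply: (@le_trans _ _ (`|a| `^ p)); last by rewrite lerDl powR_ge0.
  rewrite -(mulr_powRB1 (normr_ge0 a) pp) mulrC.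
  by apply: ler_wpM2r; rewrite ?powR_ge0.
apply: (@le_trans _ _ (`|b| `^ p)); last by rewrite lerDr powR_ge0.
rewrite -(mulr_powRB1 (normr_ge0 b) pp) mulrC.
by apply: ler_wpM2l; rewrite// ge0_ler_powR ?nnegrE ?(ltW q0).
Qed.

(** Each of a, b, d is at most their maximum m, and (3m)^p = 3^p m^p. *)
Lemma powR_sum3 a b d : 0 <= a -> 0 <= b -> 0 <= d ->
  (a + b + d) `^ p <= 3 `^ p * (a `^ p + b `^ p + d `^ p).
Proof.
move=> a0 b0 d0.
have p0 : 0 <= p := ltW (lt_trans ltr01 p1).
have key m : 0 <= m -> a <= m -> b <= m -> d <= m ->
    (a + b + d) `^ p <= 3 `^ p * m `^ p.
  move=> m0 am bm dm; rewrite -powRM//.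
  by apply: ge0_ler_powR; rewrite ?nnegrE ?addr_ge0 ?mulr_ge0//; lra.
have := powR_ge0 a p; have := powR_ge0 b p; have := powR_ge0 d p.
set A := a `^ p; set B := b `^ p; set E := d `^ p => E0 B0 A0.
have tr m : 0 <= m -> a <= m -> b <= m -> d <= m -> m `^ p <= A + B + E ->
    (a + b + d) `^ p <= 3 `^ p * (A + B + E).
  move=> m0 am bm dm mS; apply: (le_trans (key m m0 am bm dm)).
  by apply: ler_wpM2l; rewrite ?powR_ge0.
have [ab|/ltW ab] := leP a b; have [bd|/ltW bd] := leP b d.
- by apply: (tr d) => //; rewrite -/E; lra.
- by apply: (tr b) => //; rewrite -/B; lra.
- have [ad|/ltW ad] := leP a d.
    by apply: (tr d) => //; rewrite -/E; lra.
  by apply: (tr a) => //; rewrite -/A; lra.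
- by apply: (tr a) => //; rewrite -/A; lra.
Qed.

End signed_power.

(** * Lebesgue measure on the space of row vectors *)

Section euclidean_space.
Context {R : realType} {N : nat}.
Local Notation rV := 'rV[R]_N.
Local Notation mu := (rV_lebesgue R N).
Implicit Types (x y : rV) (r : R).

Lemma coord_le_norm x (i : 'I_N) : `|x 0 i| <= `|x|.
Proof.
rewrite [leRHS]/Num.norm /= mx_normrE.
by apply: (le_bigmax (0 : R) (fun ij => `|x ij.1 ij.2|) (ord0, i)).
Qed.

Lemma norm_leP x r : 0 <= r -> (forall i, `|x 0 i| <= r) -> `|x| <= r.
Proof.
move=> r0 xr; rewrite [leLHS]/Num.norm /= mx_normrE.
apply: bigmax_le => // -[a b] _ /=; by rewrite (ord1 a).
Qed.

Lemma norm_le_enorm x : `|x| <= enorm x.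
Proof.
apply: norm_leP; first exact: sqrtr_ge0.
move=> i; rewrite -sqrtr_sqr ler_wsqrtr// (bigD1 i)//= lerDl.
by apply: sumr_ge0 => j _; exact: sqr_ge0.
Qed.

Lemma enorm_le_norm x : enorm x <= N%:R * `|x|.
Proof.
rewrite -[leRHS]ger0_norm ?mulr_ge0// -sqrtr_sqr ler_wsqrtr// exprMn.
apply: (@le_trans _ _ (\sum_(i < N) `|x| ^+ 2)).
  apply: ler_sum => i _; rewrite -real_normK ?num_real//.
  by rewrite lerXn2r ?nnegrE// coord_le_norm.
rewrite sumr_const card_ord -[leLHS]mulr_natl ler_wpM2r ?sqr_ge0//.
by rewrite -natrX ler_nat; case: (N) => // n; rewrite expnS leq_pmulr// expn_gt0.
Qed.

Lemma measurable_norm_rV : measurable_fun setT (fun x => `|x|).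
Proof.
apply: (measurability _ (RGenOpens.measurableE R)) => //.
move=> _ [_ [a [b ->]] <-]; rewrite setTI; apply: measurable_open_rV.
by apply: open_comp; [move=> x _; exact: norm_continuous|exact: interval_open].
Qed.

Lemma measurable_subrV : measurable_fun setT (fun z : rV * rV => z.1 - z.2).
Proof.
apply: measurable_fun_rV => i.
apply: (eq_measurable_fun (fun z : rV * rV => z.1 0 i - z.2 0 i)).
  by move=> z _; rewrite !mxE.
have mc := @measurable_coord R N i; apply: measurable_funB.
  exact: (measurableT_comp mc measurable_fst).
exact: (measurableT_comp mc measurable_snd).
Qed.

Lemma measurable_enorm : measurable_fun setT (@enorm R N).
Proof.
have msqrt : measurable_fun setT (@Num.sqrt R).
  by apply: continuous_measurable_fun; exact: sqrt_continuous.
apply: (measurableT_comp msqrt); apply: measurable_sum => i.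
by apply: measurable_funX; exact: measurable_coord.
Qed.

Lemma measurable_normB : measurable_fun setT (fun z : rV * rV => `|z.1 - z.2|).
Proof.
exact: (measurableT_comp measurable_norm_rV measurable_subrV).
Qed.

Lemma measurable_cube x r : measurable [set y : rV | `|x - y| <= r].
Proof.
have : measurable_fun setT (fun y : rV => `|x - y|).
  exact: (measurableT_comp measurable_normB (pair1_measurable x)).
move=> /(_ measurableT `]-oo, r]%classic); rewrite setTI => H.
rewrite [X in measurable X](_ : _ = (fun y : rV => `|x - y|) @^-1` `]-oo, r]%classic).
  exact: H.
by apply/seteqP; split => y /=; rewrite in_itv.
Qed.

Lemma lebesgue_cube x r : 0 <= r ->
  mu [set y : rV | `|x - y| <= r] = ((2 * r) ^+ N)%:E.
Proof.
move=> r0.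
have -> : [set y : rV | `|x - y| <= r] =
    [set y | forall i, `[x 0 i - r, x 0 i + r]%classic (y 0 i)].
  apply/seteqP; split => y /= yr.
    move=> i; rewrite in_itv/= -ler_distlC.
    by have := coord_le_norm (x - y) i; rewrite !mxE distrC => /le_trans; apply.
  apply: norm_leP => // i; have := yr i; rewrite in_itv/= -ler_distlC !mxE.
  by rewrite distrC.
rewrite (rV_lebesgue_box (B := fun i => `[x 0 i - r, x 0 i + r]%classic)) => [|i];
  last exact: measurable_itv.
rewrite (eq_bigr (fun=> (2 * r)%:E)); last first.
  move=> i _; rewrite lebesgue_measure_itv/= lte_fin.
  case: ltP => [_|]; first by rewrite -EFinB; congr EFin; ring.
  by move=> H; congr EFin; lra.
by rewrite prodEFin prodr_const card_ord.
Qed.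

Lemma lebesgue_set1 x : (0 < N)%N -> mu [set x] = 0%E.
Proof.
move=> N0; have -> : [set x] = [set y : rV | `|x - y| <= 0].
  apply/seteqP; split => y /=; first by move=> ->; rewrite subrr normr0.
  by rewrite normr_le0 subr_eq0 => /eqP.
by rewrite lebesgue_cube// mulr0 expr0n -[N == _]negbK -lt0n N0.
Qed.

Lemma compact_cube x r : compact [set y : rV | `|x - y| <= r].
Proof.
apply: bounded_closed_compact.
  exists (`|x| + r); split; first exact: num_real.
  move=> M /ltW Mr y /= yr; apply: le_trans Mr.
  by rewrite -[y](subKr x) (le_trans (ler_normB _ _))// lerD2l.
apply: (@closed_comp _ _ (fun y : rV => `|x - y|) [set t | t <= r]).
  move=> y _; apply: continuous_comp; last exact: norm_continuous.
  by apply: continuousB => //; exact: cst_continuous.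
exact: closed_le.
Qed.

End euclidean_space.

Section swap.
Context {d} {T : measurableType d} {R : realType}.
Variable m : {sigma_finite_measure set T -> \bar R}.

(** Tonelli's theorem in both orders. *)
Lemma ge0_integral_swap (f : T * T -> \bar R) :
  measurable_fun setT f -> (forall z, 0 <= f z)%E ->
  (\int[m \x m]_z f (z.2, z.1) = \int[m \x m]_z f z)%E.
Proof.
move=> mf f0.
have mfs : measurable_fun setT (fun z : T * T => f (z.2, z.1)).
  exact: (measurableT_comp mf (@measurable_swap _ _ T T)).
rewrite (fubini_tonelli1 (fun z : T * T => f (z.2, z.1)))//.
by rewrite (fubini_tonelli2 f).
Qed.

End swap.

(** * Integrals of truncated singular kernels *)

Section singular_kernel.
Context {R : realType} {N : nat}.
Local Notation rV := 'rV[R]_N.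
Local Notation mu := (rV_lebesgue R N).

(** As a function of t = |x-y|, the kernel t^-(N+sg) tamed near the origin by t^g. *)
Definition trunc_kernel (g sg t : R) : R :=
  Num.min (t `^ g) 1 * t `^ (- (N%:R + sg)).

Lemma trunc_kernel_ge0 g sg t : 0 <= trunc_kernel g sg t.
Proof. by rewrite mulr_ge0 ?powR_ge0// le_min powR_ge0/=. Qed.

Lemma measurable_trunc_kernel g sg : measurable_fun setT (trunc_kernel g sg).
Proof.
apply: measurable_funM; last exact: measurable_powR.
by apply: measurable_minr; [exact: measurable_powR|exact: measurable_cst].
Qed.

Lemma powR_exprn (x a : R) k : 0 <= x -> (x ^+ k) `^ a = (x `^ a) ^+ k.
Proof.
move=> x0; elim: k => [|k IH]; first by rewrite !expr0 powR1.
by rewrite !exprS powRM ?exprn_ge0// IH.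
Qed.

Lemma powR_half_lt1 (a : R) : 0 < a -> 2^-1 `^ a < 1 :> R.
Proof.
move=> a0; have one : 1 `^ a = 1 :> R by rewrite powR1.
rewrite -[ltRHS]one; apply: gt0_ltr_powR; rewrite ?nnegrE ?invr_ge0//.
by rewrite invf_lt1// ltr1n.
Qed.

Lemma powR_inv (x a : R) : 0 <= x -> x^-1 `^ a = x `^ (- a).
Proof. by move=> x0; rewrite -powR_inv1// -powRrM mulN1r. Qed.

Lemma geometric_le (x : R) n : 0 <= x -> x < 1 ->
  \sum_(0 <= k < n) x ^+ k <= (1 - x)^-1.
Proof.
move=> x0 x1; have x1' : 0 < 1 - x by rewrite subr_gt0.
rewrite -[leRHS]mul1r ler_pdivlMr//.
have := subrX1 x n; rewrite big_mkord => E.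
have : 0 <= x ^+ n by exact: exprn_ge0.
rewrite mulrC; move: E; set S := \sum_(_ < _) _ => E; nra.
Qed.

(** The k-th term of the dyadic majorant: the first summand is active for t <= 2^-k and
    handles the scale t ~ 2^-k near the diagonal, the second the scale t ~ 2^k at infinity. *)
Let shell (g sg : R) (k : nat) (t : R) : R :=
  (2^-1 `^ (g - sg)) ^+ k * 2 ^+ (k.+1 * N) * (t <= 2^-1 ^+ k)%R%:R +
  (2^-1 `^ sg) ^+ k * 2^-1 ^+ (k * N) * (t <= 2 ^+ k.+1)%R%:R.

Let shell_ge0 g sg k t : 0 <= shell g sg k t.
Proof. by rewrite addr_ge0// !mulr_ge0 ?exprn_ge0 ?powR_ge0 ?invr_ge0. Qed.

Let trunc_kernel_le_shell g sg t : 0 < sg -> sg < g -> 0 <= t ->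
  exists k, trunc_kernel g sg t <= shell g sg k t.
Proof.
move=> sg0 gsg; rewrite le_eqVlt => /predU1P[<-|t0].
  exists 0%N; rewrite /trunc_kernel powR0 ?gt_eqF ?(lt_trans sg0)//.
  by rewrite min_l// mul0r.
have split_pow (a : R) : t `^ (- (N%:R + a)) = t `^ (- a) * t ^- N.
  rewrite opprD addrC powRD; last by rewrite (gt_eqF t0) implybT.
  by rewrite powR_invn// ltW.
have [t1|t1] := leP t 1.
  have exk : exists k, 2^-1 ^+ k.+1 < t.
    exists (Num.Def.archi_bound t^-1); rewrite exprVn invf_plt ?posrE ?exprn_gt0//.
    by apply: upper_nthrootP.
  (* the scale 2^-k of t *)
  case: (ex_minnP exk) => k kt kmin; exists k.
  have tk : t <= 2^-1 ^+ k.
    case: k kt kmin => [_ _|k _ kmin]; first by rewrite expr0.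
    rewrite leNgt; apply/negP => /kmin; by rewrite ltnn.
  rewrite /trunc_kernel /shell tk mulr1 -[leLHS]addr0; apply: lerD; last first.
    by rewrite !mulr_ge0 ?exprn_ge0 ?powR_ge0 ?invr_ge0.
  apply: (@le_trans _ _ (t `^ g * t `^ (- (N%:R + sg)))).
    by apply: ler_wpM2r; rewrite ?powR_ge0 ?ge_min ?lexx.
  rewrite split_pow mulrA -powRD; last by rewrite (gt_eqF t0) implybT.
  apply: ler_pM; rewrite ?powR_ge0 ?invr_ge0 ?exprn_ge0 ?(ltW t0)//.
    rewrite -powR_exprn ?invr_ge0//.
    by apply: ge0_ler_powR; rewrite ?nnegrE ?exprn_ge0 ?invr_ge0 ?subr_ge0 ?(ltW t0) ?(ltW gsg).
  rewrite exprM -exprVn lerXn2r ?nnegrE ?invr_ge0 ?exprn_ge0 ?(ltW t0)//.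
  rewrite -[leRHS]invrK lef_pV2 ?posrE ?invr_gt0 ?exprn_gt0//.
  by rewrite -exprVn ltW.
have exk : exists k, t <= 2 ^+ k.+1.
  exists (Num.Def.archi_bound t); apply/ltW.
  by apply: upper_nthrootP.
(* the scale 2^k of t *)
case: (ex_minnP exk) => k kt kmin; exists k.
have tk : 2 ^+ k <= t.
  case: k kt kmin => [_ _|k _ kmin]; first by rewrite expr0 ltW.
  rewrite leNgt; apply/negP => /ltW /kmin; by rewrite ltnn.
rewrite /trunc_kernel /shell kt mulr1 -[leLHS]add0r; apply: lerD.
  by rewrite !mulr_ge0 ?exprn_ge0 ?powR_ge0 ?invr_ge0.
apply: (@le_trans _ _ (1 * t `^ (- (N%:R + sg)))).
  by apply: ler_wpM2r; rewrite ?powR_ge0 ?ge_min ?lexx ?orbT.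
have tV : t^-1 <= 2^-1 ^+ k by rewrite exprVn lef_pV2 ?posrE ?exprn_gt0.
rewrite mul1r split_pow; apply: ler_pM.
- by rewrite powR_ge0.
- by rewrite invr_ge0 exprn_ge0 ?(ltW t0).
- rewrite -powR_inv ?(ltW t0)// -powR_exprn ?invr_ge0//.
  by apply: ge0_ler_powR; rewrite ?nnegrE ?exprn_ge0 ?invr_ge0 ?(ltW t0) ?(ltW sg0).
- by rewrite exprM -exprVn lerXn2r ?nnegrE ?invr_ge0 ?exprn_ge0 ?(ltW t0).
Qed.

Let cubeE (x : rV) r y :
  \1_[set y : rV | `|x - y| <= r] y = (`|x - y| <= r)%R%:R :> R.
Proof. by rewrite indicE; congr (_ %:R); congr nat_of_bool; apply/idP/idP; rewrite inE. Qed.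

Let integral_cube (x : rV) (c r : R) : 0 <= c -> 0 <= r ->
  (\int[mu]_y (c * (`|x - y| <= r)%R%:R)%:E = (c * (2 * r) ^+ N)%:E)%E.
Proof.
move=> c0 r0; pose A := [set y : rV | `|x - y| <= r].
have mA : measurable A by exact: measurable_cube.
transitivity (\int[mu]_y (c%:E * (\1_A y)%:E))%E.
  apply: eq_integral => y _; rewrite EFinM; congr (_ * _%:E)%E.
  by rewrite cubeE.
rewrite ge0_integralZl_EFin//; last by apply/measurable_EFinP; exact: measurable_indic.
rewrite integral_indic// setIT EFinM; congr (_ * _)%E.
exact: lebesgue_cube.
Qed.

(** On the dyadic shells t ~ 2^-k and t ~ 2^k, the volume of the cube cancels t^-N;
    what remains is a multiple of 2^-k(g-sg), respectively 2^-k sg.  Bounding the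
    kernel by the sum of these constants times indicators of cubes centred at x
    makes the bound uniform in x. *)
Lemma integral_trunc_kernel g sg : 0 < sg -> sg < g ->
  exists2 C : R, 0 <= C & forall x : rV,
    (\int[mu]_y (trunc_kernel g sg `|x - y|)%:E <= C%:E)%E.
Proof.
move=> sg0 gsg; set u := (2^-1 `^ (g - sg) : R); set w := (2^-1 `^ sg : R).
have u0 : 0 <= u by exact: powR_ge0.
have w0 : 0 <= w by exact: powR_ge0.
have u1 : u < 1 by rewrite powR_half_lt1// subr_gt0.
have w1 : w < 1 by rewrite powR_half_lt1.
exists (4 ^+ N * ((1 - u)^-1 + (1 - w)^-1)).
  by rewrite mulr_ge0 ?exprn_ge0 ?addr_ge0 ?invr_ge0 ?subr_ge0 ?(ltW u1) ?(ltW w1).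
move=> x; have mn : measurable_fun setT (fun y : rV => `|x - y|).
  exact: (measurableT_comp measurable_normB (pair1_measurable x)).
have mle (c r : R) : measurable_fun setT (fun y : rV => c * (`|x - y| <= r)%R%:R).
  have -> : (fun y : rV => c * (`|x - y| <= r)%R%:R) =
      (fun y => c * \1_[set y : rV | `|x - y| <= r] y).
    by apply/funext => y; rewrite cubeE.
  apply: measurable_funM => //; apply: measurable_indic; exact: measurable_cube.
have msh k : measurable_fun setT (fun y : rV => (shell g sg k `|x - y|)%:E).
  by apply/measurable_EFinP; apply: measurable_funD; exact: mle.
apply: (@le_trans _ _ (\int[mu]_y \sum_(k <oo) (shell g sg k `|x - y|)%:E)%E).
  apply: ge0_le_integral => //.
  - by move=> y _; rewrite lee_fin trunc_kernel_ge0.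
  - apply/measurable_EFinP.
    exact: (measurableT_comp (measurable_trunc_kernel g sg) mn).
  - by apply: ge0_emeasurable_sum => // k y _ _; rewrite lee_fin.
  - move=> y _; have [k yk] := trunc_kernel_le_shell sg0 gsg (normr_ge0 (x - y)).
    apply: (@le_trans _ _ (\sum_(0 <= i < k.+1) (shell g sg i `|x - y|)%:E)%E).
      rewrite big_nat_recr//= (le_trans (y := (shell g sg k `|x - y|)%:E)) ?lee_fin//.
      by rewrite leeDr// sume_ge0// => i _; rewrite lee_fin.
    by apply: nneseries_lim_ge => n _ _; rewrite lee_fin.
rewrite integral_nneseries// => [|k y _]; last by rewrite lee_fin.
have ik k : (\int[mu]_y (shell g sg k `|x - y|)%:E = (4 ^+ N * (u ^+ k + w ^+ k))%:E)%E.
  rewrite /shell; under eq_integral do rewrite EFinD.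
  rewrite ge0_integralD//=.
  - rewrite !integral_cube ?exprn_ge0 ?invr_ge0 ?mulr_ge0 ?exprn_ge0 ?invr_ge0//.
    rewrite -EFinD; congr EFin.
    have two : 2 != 0 :> R by rewrite pnatr_eq0.
    rewrite !exprM -/u -/w -!mulrA -!exprMn mulrDr.
    have -> : 2 ^+ k.+1 * (2 * 2^-1 ^+ k) = 4 :> R.
      by rewrite exprVn exprS; field; rewrite expf_neq0.
    have -> : 2^-1 ^+ k * (2 * 2 ^+ k.+1) = 4 :> R.
      by rewrite exprVn exprS; field; rewrite expf_neq0.
    by rewrite mulrC (mulrC (w ^+ k)).
  - by apply/measurable_EFinP; exact: mle.
  - by apply/measurable_EFinP; exact: mle.
under eq_eseriesr do rewrite ik.
apply: lime_le.
  by apply: is_cvg_nneseries => n _ _; rewrite lee_fin mulr_ge0 ?addr_ge0 ?exprn_ge0.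
apply: nearW => n; rewrite sumEFin lee_fin -mulr_sumr ler_wpM2l ?exprn_ge0//.
by rewrite big_split/=; apply: lerD; exact: geometric_le.
Qed.

End singular_kernel.

(** * Kernel bounds, the tent function and the growth of increments *)

Section kernel.
Context {R : realType} {N : nat}.
Variables s p : R.
Hypotheses (s0 : 0 < s) (p1 : 1 < p).
Local Notation rV := 'rV[R]_N.

Let sp0 : 0 < s * p. Proof. by rewrite mulr_gt0// (lt_trans ltr01). Qed.
Let Nsp0 : 0 < N%:R + s * p. Proof. by rewrite ltr_wpDl. Qed.

Lemma enorm_distC (x y : rV) : enorm (x - y) = enorm (y - x).
Proof.
by rewrite /enorm; congr Num.sqrt; apply: eq_bigr => i _; rewrite !mxE -sqrrN opprB.
Qed.

Lemma nl_kernelC (x y : rV) : nl_kernel s p (x, y) = nl_kernel s p (y, x).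
Proof. by rewrite /nl_kernel/= enorm_distC. Qed.

Lemma nl_kernelV_ge0 (z : rV * rV) : 0 <= (nl_kernel s p z)^-1.
Proof. by rewrite invr_ge0 powR_ge0. Qed.

(** Here the Euclidean norm of the kernel is exchanged for the sup norm, whose balls
    are cubes; both sides vanish on the diagonal. *)
Lemma nl_kernelV_le (z : rV * rV) :
  (nl_kernel s p z)^-1 <= `|z.1 - z.2| `^ (- (N%:R + s * p)).
Proof.
rewrite powRN /nl_kernel.
have [z0|z0] := eqVneq `|z.1 - z.2| 0.
  have /eqP -> : z.1 - z.2 == 0 by rewrite -normr_eq0 z0.
  suff -> : enorm (0 : rV) = 0 by rewrite normr0.
  by apply/eqP; rewrite eq_le sqrtr_ge0 (le_trans (enorm_le_norm _))// normr0 mulr0.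
have zp : 0 < `|z.1 - z.2| by rewrite lt_neqAle eq_sym z0 /=.
have ep := lt_le_trans zp (norm_le_enorm _).
rewrite lef_pV2 ?posrE ?powR_gt0//.
by apply: ge0_ler_powR; rewrite ?nnegrE ?sqrtr_ge0 ?norm_le_enorm// ltW.
Qed.

Lemma nl_kernelV_ge (z : rV * rV) (b : R) : (0 < N)%N ->
  0 < `|z.1 - z.2| -> `|z.1 - z.2| <= b ->
  (N%:R * b) `^ (- (N%:R + s * p)) <= (nl_kernel s p z)^-1.
Proof.
move=> N0 z0 zb; rewrite powRN /nl_kernel.
have ep := lt_le_trans z0 (norm_le_enorm _).
have b0 := lt_le_trans z0 zb.
rewrite lef_pV2 ?posrE ?powR_gt0 ?mulr_gt0 ?ltr0n//.
apply: ge0_ler_powR; rewrite ?nnegrE ?sqrtr_ge0 ?(ltW Nsp0)//.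
  by rewrite mulr_ge0 ?ler0n ?ltW.
by rewrite (le_trans (enorm_le_norm _))// ler_wpM2l.
Qed.

Lemma measurable_nl_kernelV : measurable_fun setT (fun z : rV * rV => (nl_kernel s p z)^-1).
Proof.
apply: (eq_measurable_fun (fun z : rV * rV => enorm (z.1 - z.2) `^ (- (N%:R + s * p)))).
  by move=> z _; rewrite powRN.
apply: (measurableT_comp (measurable_powR _)).
exact: (measurableT_comp measurable_enorm measurable_subrV).
Qed.

End kernel.

Section bump.
Context {R : realType} {N : nat}.
Local Notation rV := 'rV[R]_N.
Variables (x0 : rV) (r : R).
Hypothesis r0 : 0 < r.

Definition tent (x : rV) : R := Num.max 0 (1 - `|x0 - x| / r).

Lemma tent_ge0 x : 0 <= tent x.
Proof. by rewrite le_max lexx. Qed.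

Lemma tent_le1 x : tent x <= 1.
Proof. by rewrite ge_max ler01/= gerBl divr_ge0// ltW. Qed.

Lemma tent_eq0 x : r <= `|x0 - x| -> tent x = 0.
Proof. by move=> xr; rewrite /tent max_l// subr_le0 ler_pdivlMr// mul1r. Qed.

Lemma tent_ge_half x : `|x0 - x| <= r / 2 -> 2^-1 <= tent x.
Proof.
move=> xr; rewrite le_max; apply/orP; right.
have : `|x0 - x| / r <= 2^-1 by rewrite ler_pdivrMr// mulrC.
lra.
Qed.

Lemma tent_lipschitz x y : `|tent x - tent y| <= Num.min (`|x - y| / r) 1.
Proof.
have tx := tent_ge0 x; have ty := tent_ge0 y.
have tx1 := tent_le1 x; have ty1 := tent_le1 y.
rewrite le_min; apply/andP; split; last by rewrite ler_norml; lra.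
have key x' y' : tent x' - tent y' <= `|x' - y'| / r.
  have d0 : 0 <= `|x' - y'| / r by rewrite divr_ge0// ltW.
  have : `|x0 - y'| / r <= `|x0 - x'| / r + `|x' - y'| / r.
    by rewrite -mulrDl ler_pM2r ?invr_gt0// ler_distD.
  rewrite {1}/tent; case: (leP 0 (1 - `|x0 - x'| / r)) => _.
    have : 1 - `|x0 - y'| / r <= tent y' by rewrite /tent le_max lexx orbT.
    by lra.
  by have := tent_ge0 y'; lra.
by rewrite ler_norml lerNl opprB key distrC key.
Qed.

Lemma measurable_tent : measurable_fun setT tent.
Proof.
apply: measurable_maxr; first exact: measurable_cst.
apply: measurable_funB; first exact: measurable_cst.
apply: measurable_funM; last exact: measurable_cst.
exact: (measurableT_comp measurable_normB (pair1_measurable x0)).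
Qed.

End bump.

Section growth.
Context {R : realType} {N : nat}.
Variable p : R.
Hypothesis p1 : 1 < p.
Local Notation rV := 'rV[R]_N.
Local Notation h := (signed_pow p).

(** Truncating at distance r or at distance 1 only changes constants. *)
Lemma min_powR_scale (g r t : R) : 0 < g -> 0 < r -> 0 <= t ->
  (Num.min (t / r) 1) `^ g <= (1 + r^-1 `^ g) * Num.min (t `^ g) 1.
Proof.
move=> g0 r0 t0.
have tr0 : 0 <= t / r by rewrite divr_ge0// ltW.
have m0 : 0 <= Num.min (t / r) 1 by rewrite le_min tr0 ler01.
have rg0 : 0 <= r^-1 `^ g := powR_ge0 _ _.
have mono := ge0_ler_powR (ltW g0).
have A : (Num.min (t / r) 1) `^ g <= t `^ g * r^-1 `^ g.
  by rewrite -powRM ?invr_ge0 ?(ltW r0)//; apply: mono; rewrite ?nnegrE// ge_min lexx.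
have B : (Num.min (t / r) 1) `^ g <= 1.
  have one : 1 `^ g = 1 :> R by rewrite powR1.
  by rewrite -[leRHS]one; apply: mono; rewrite ?nnegrE// ge_min lexx orbT.
have tg0 : 0 <= t `^ g := powR_ge0 _ _.
case: (leP (t `^ g) 1) => _; last by rewrite mulr1 (le_trans B)// lerDl.
by rewrite mulrDl mul1r (le_trans A)// mulrC lerDr.
Qed.

(** For p <= 2 the modulus of continuity of h does not depend on the base point, so
    the increment of w disappears from the estimate. *)
Lemma signed_pow_growth_sublinear (w : rV -> R) (x0 : rV) (r : R) :
  0 < r -> p <= 2 ->
  exists2 C : R, 0 <= C & forall (a : R) x y, 0 <= a ->
    `|h (w x - w y + a * (tent x0 r x - tent x0 r y)) - h (w x - w y)| <=
    C * a `^ (p - 1) * Num.min (`|x - y| `^ (p - 1)) 1.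
Proof.
move=> r0 p2; have q0 : 0 < p - 1 by rewrite subr_gt0.
exists (2 * (1 + r^-1 `^ (p - 1))).
  by rewrite mulr_ge0// addr_ge0// powR_ge0.
move=> a x y a0; apply: (le_trans (signed_pow_le2 p1 _ _ p2)).
rewrite [_ + a * _]addrC addrK normrM (ger0_norm a0) powRM//.
rewrite -!mulrA ler_pM2l// (mulrCA (1 + _)) ler_wpM2l ?powR_ge0//.
apply: le_trans (min_powR_scale q0 r0 (normr_ge0 (x - y))).
apply: ge0_ler_powR; rewrite ?nnegrE ?(ltW q0) ?tent_lipschitz//.
by rewrite le_min ler01 divr_ge0// ltW.
Qed.

(** For |x-y| <= r the increments of w and of the tent are both O(|x-y|^al), so the
    Lipschitz constant of h there is O(|x-y|^(al(p-2))), and the tent contributes one more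
    factor |x-y|.  For |x-y| > r boundedness of w is enough. *)
Lemma signed_pow_growth_hoelder (Z : set rV) (w : rV -> R) (x0 : rV) (r L H al : R) :
  0 < r -> 2 <= p -> 0 < al -> al <= 1 -> 0 <= L -> 0 <= H ->
  (forall x, ~ Z x -> `|w x| <= L) ->
  (forall x y, ~ Z x -> ~ Z y -> `|x0 - x| <= 2 * r -> `|x0 - y| <= 2 * r ->
     `|w x - w y| <= H * `|x - y| `^ al) ->
  exists2 C : R, 0 <= C & forall (a : R) x y, 0 <= a -> a <= 1 ->
    ~ Z x -> ~ Z y -> `|x0 - x| <= r ->
    `|h (w x - w y + a * (tent x0 r x - tent x0 r y)) - h (w x - w y)| <=
    C * a * Num.min (`|x - y| `^ (al * (p - 2) + 1)) 1.
Proof.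
move=> r0 p2 al0 al1 L0 H0 wL wH.
set g := al * (p - 2) + 1.
have p20 : 0 <= p - 2 by rewrite subr_ge0.
have alp0 : 0 <= al * (p - 2) by rewrite mulr_ge0// ltW.
have g0 : 0 < g by rewrite ltr_wpDl.
have [n pn] : exists n : nat, p - 1 <= n%:R.
  exists (Num.truncn (p - 1)).+1; exact/ltW/truncnS_gt.
(* for |x-y| <= r the increments of w and of the tent are at most H1 |x-y|^al,
   because |x-y| <= r^(1-al) |x-y|^al there *)
set H1 := H + r `^ (1 - al) / r.
have H10 : 0 <= H1 by rewrite addr_ge0// divr_ge0 ?powR_ge0// ltW.
set C1 := n%:R * H1 `^ (p - 2) / r * (1 + r `^ g).
set C2 := n%:R * (L + L + 1) `^ (p - 2) * (1 + r^-1 `^ g).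
have C10 : 0 <= C1.
  by rewrite /C1 mulr_ge0 ?addr_ge0 ?powR_ge0// divr_ge0 ?(ltW r0)// mulr_ge0 ?powR_ge0.
have C20 : 0 <= C2 by rewrite /C2 !mulr_ge0 ?addr_ge0 ?powR_ge0.
exists (C1 + C2); first by rewrite addr_ge0.
move=> a x y a0 a1 Zx Zy xr; set A := w x - w y; set B := a * _.
set t := `|x - y|; have t0 : 0 <= t := normr_ge0 _.
have tl := tent_lipschitz x0 r0 x y.
have Bt : `|B| <= a * (t / r).
  by rewrite normrM (ger0_norm a0) ler_wpM2l// (le_trans tl)// ge_min lexx.
have B1 : `|B| <= a.
  rewrite normrM (ger0_norm a0) -[leRHS]mulr1 ler_wpM2l// (le_trans tl)//.
  by rewrite ge_min lexx orbT.
have m0 : 0 <= Num.min (t `^ g) 1 by rewrite le_min powR_ge0 ler01.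
have tg0 : 0 <= t `^ g := powR_ge0 _ _.
suff : `|h (A + B) - h A| <= C1 * a * Num.min (t `^ g) 1 \/
       `|h (A + B) - h A| <= C2 * a * Num.min (t `^ g) 1.
  by move=> [] /le_trans; apply; apply: ler_wpM2r => //; apply: ler_wpM2r => //; lra.
have [tr|rt] := leP t r; [left|right].
- have yr : `|x0 - y| <= 2 * r.
    by rewrite (le_trans (ler_distD x _ _))// mulr2n mulrDl mul1r lerD.
  have xr' : `|x0 - x| <= 2 * r by rewrite (le_trans xr)//; lra.
  have AH : `|A| <= H * t `^ al by exact: wH.
  have tal : t / r <= r `^ (1 - al) / r * t `^ al.
    rewrite mulrAC ler_pM2r ?invr_gt0//.
    have [->|tn0] := eqVneq t 0; first by rewrite mulr_ge0 ?powR_ge0.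
    have tE : t = t `^ (1 - al) * t `^ al.
      by rewrite -powRD ?subrK ?powRr1// tn0 implybT.
    rewrite [leLHS]tE; apply: ler_wpM2r; first exact: powR_ge0.
    by apply: ge0_ler_powR; rewrite ?nnegrE ?subr_ge0 ?(ltW r0).
  have m1 : `|A| <= H1 * t `^ al.
    by rewrite mulrDl (le_trans AH)// lerDl !mulr_ge0 ?powR_ge0 ?invr_ge0 ?(ltW r0).
  have Btr : `|B| <= t / r.
    by rewrite (le_trans Bt)// ler_piMl// divr_ge0// ltW.
  have m2 : `|A + B| <= H1 * t `^ al.
    by rewrite mulrDl (le_trans (ler_normD _ _))// lerD// (le_trans Btr).
  apply: (le_trans (signed_pow_ge2 p1 p2 pn m2 m1)).
  rewrite [A + B]addrC addrK.
  apply: (@le_trans _ _ (n%:R * (H1 * t `^ al) `^ (p - 2) * (a * (t / r)))).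
    by apply: ler_wpM2l => //; rewrite mulr_ge0 ?powR_ge0.
  rewrite powRM ?powR_ge0// -powRrM.
  have -> : n%:R * (H1 `^ (p - 2) * t `^ (al * (p - 2))) * (a * (t / r)) =
      n%:R * H1 `^ (p - 2) / r * a * (t * t `^ (al * (p - 2))) by ring.
  have -> : t * t `^ (al * (p - 2)) = t `^ g.
    by rewrite -(mulr_powRB1 t0 g0); congr (_ * _ `^ _); rewrite /g addrK.
  have -> : C1 * a * Num.min (t `^ g) 1 =
      n%:R * H1 `^ (p - 2) / r * a * ((1 + r `^ g) * Num.min (t `^ g) 1).
    by rewrite /C1; ring.
  apply: ler_wpM2l.
    by rewrite mulr_ge0// divr_ge0 ?(ltW r0)// mulr_ge0 ?powR_ge0.
  have rg : t `^ g <= r `^ g.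
    by apply: ge0_ler_powR; rewrite ?nnegrE ?(ltW g0) ?(ltW r0).
  by case: (leP (t `^ g) 1) => _; [nra|lra].
- have AL : `|A| <= L + L by rewrite (le_trans (ler_normB _ _))// lerD// wL.
  have m1 : `|A| <= L + L + 1 by rewrite (le_trans AL)// lerDl.
  have m2 : `|A + B| <= L + L + 1.
    by rewrite (le_trans (ler_normD _ _))// lerD// (le_trans B1).
  apply: (le_trans (signed_pow_ge2 p1 p2 pn m2 m1)).
  rewrite [A + B]addrC addrK.
  have -> : C2 * a * Num.min (t `^ g) 1 =
      n%:R * (L + L + 1) `^ (p - 2) * (a * ((1 + r^-1 `^ g) * Num.min (t `^ g) 1)).
    by rewrite /C2; ring.
  apply: ler_wpM2l; first by rewrite mulr_ge0 ?powR_ge0.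
  apply: (le_trans B1); rewrite -[leLHS]mulr1; apply: ler_wpM2l => //.
  have : 1 <= t `^ g * r^-1 `^ g.
    rewrite -powRM ?invr_ge0 ?(ltW r0)//.
    have one : 1 `^ g = 1 :> R by rewrite powR1.
    rewrite -[leLHS]one; apply: ge0_ler_powR; rewrite ?nnegrE ?(ltW g0)//.
      by rewrite divr_ge0// ltW.
    by rewrite ler_pdivlMr// mul1r ltW.
  have : 0 <= r^-1 `^ g := powR_ge0 _ _.
  by case: (leP (t `^ g) 1) => _; [nra|lra].
Qed.

(** Insert h(Wx - Wy).  The difference h(vx - vy) - h(Wx - Wy) has the sign opposite
    to fx - fy, because fx and fy are nondecreasing functions of Wx - vx and Wy - vy.
    In the rest, oddness of h turns the contribution of fy into that of fx with
    the two points exchanged, so only one-sided bounds where fx or fy is positive are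
    needed. *)
Lemma comparison_integrand_le (vx vy wx wy Wx Wy fx fy Gx Gy k : R) :
  0 <= k -> fx = Num.max 0 (Wx - vx) -> fy = Num.max 0 (Wy - vy) ->
  (0 < fx -> (h (Wx - Wy) - h (wx - wy)) * k <= Gx) ->
  (0 < fy -> (h (Wy - Wx) - h (wy - wx)) * k <= Gy) ->
  (h (vx - vy) - h (wx - wy)) * (fx - fy) * k <= Gx * fx + Gy * fy.
Proof.
move=> k0 fxE fyE HGx HGy.
have fx0 : 0 <= fx by rewrite fxE le_max lexx.
have fy0 : 0 <= fy by rewrite fyE le_max lexx.
have mono : (h (vx - vy) - h (Wx - Wy)) * (fx - fy) <= 0.
  have [dle|dgt] := leP (Wx - vx) (Wy - vy).
    apply: mulr_ge0_le0; first by rewrite subr_ge0 le_signed_pow//; lra.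
    by rewrite subr_le0 fxE fyE ge_max !le_max lexx dle orbT.
  apply: mulr_le0_ge0; first by rewrite subr_le0 le_signed_pow//; lra.
  by rewrite subr_ge0 fxE fyE ge_max !le_max lexx (ltW dgt) orbT.
have Ax : (h (Wx - Wy) - h (wx - wy)) * k * fx <= Gx * fx.
  move: fx0; rewrite le_eqVlt => /predU1P[<-|fxp]; first by rewrite !mulr0.
  by rewrite ler_pM2r// HGx.
have Ay : (h (Wy - Wx) - h (wy - wx)) * k * fy <= Gy * fy.
  move: fy0; rewrite le_eqVlt => /predU1P[<-|fyp]; first by rewrite !mulr0.
  by rewrite ler_pM2r// HGy.
have Wyx : h (Wy - Wx) = - h (Wx - Wy) by rewrite -signed_powN opprB.
have wyx : h (wy - wx) = - h (wx - wy) by rewrite -signed_powN opprB.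
rewrite Wyx wyx in Ay.
apply: (le_trans _ (lerD Ax Ay)).
have -> : (h (vx - vy) - h (wx - wy)) * (fx - fy) * k =
  (h (vx - vy) - h (Wx - Wy)) * (fx - fy) * k +
  ((h (Wx - Wy) - h (wx - wy)) * k * fx + (- h (Wx - Wy) - - h (wx - wy)) * k * fy) by ring.
by rewrite gerDr mulr_le0_ge0.
Qed.

End growth.

(** * Integrals over the product space *)

Section almost_everywhere.
Context {d} {T : measurableType d} {R : realType}.
Variable m : {measure set T -> \bar R}.
Implicit Types (D Z : set T) (f g : T -> R).

Lemma ae_le_integrable D Z f g : measurable D -> measurable Z -> m Z = 0%E ->
  measurable_fun D f -> (forall x, D x -> ~ Z x -> `|f x| <= g x) ->
  m.-integrable D (EFin \o g) -> m.-integrable D (EFin \o f).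
Proof.
move=> mD mZ Z0 mf fg ig.
have mf' : measurable_fun D (EFin \o f) by exact/measurable_EFinP.
apply/(negligible_integrable mZ mD mf' Z0).
have mDZ : measurable (D `\` Z) by exact: measurableD.
apply: (le_integrable mDZ (g := EFin \o g)).
- exact: measurable_funS mf'.
- move=> x [Dx Zx] /=; rewrite lee_fin; apply: (le_trans (fg x Dx Zx)); exact: ler_norm.
- by apply: (integrableS mD mDZ _ ig) => x [].
Qed.

Lemma ae_le_integral D Z f g : measurable D -> measurable Z -> m Z = 0%E ->
  m.-integrable D (EFin \o f) -> m.-integrable D (EFin \o g) ->
  (forall x, D x -> ~ Z x -> f x <= g x) ->
  (\int[m]_(x in D) (f x)%:E <= \int[m]_(x in D) (g x)%:E)%E.
Proof.
move=> mD mZ Z0 mf mg fg.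
rewrite (negligible_integral mZ mD mf Z0) (negligible_integral mZ mD mg Z0).
have mDZ : measurable (D `\` Z) by exact: measurableD.
have DZD : D `\` Z `<=` D by move=> x [].
apply: le_integral => //.
- exact: integrableS mD mDZ DZD mf.
- exact: integrableS mD mDZ DZD mg.
- by move=> x; rewrite inE => -[Dx Zx] /=; rewrite lee_fin fg.
Qed.

Lemma ge0_integrable f : measurable_fun setT f -> (forall x, 0 <= f x) ->
  (\int[m]_x (f x)%:E < +oo)%E -> m.-integrable setT (EFin \o f).
Proof.
move=> mf f0 foo; apply/integrableP; split; first exact/measurable_EFinP.
apply: le_lt_trans foo; rewrite le_eqVlt; apply/orP; left; apply/eqP.
by apply: eq_integral => x _ /=; rewrite ger0_norm.
Qed.

End almost_everywhere.

Section double_integrals.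
Context {d} {T : measurableType d} {R : realType}.
Variable m : {sigma_finite_measure set T -> \bar R}.
Local Notation mm := (m \x m)%E.

(** Pairs with a coordinate in a null set are negligible, so the double integrals
    only see a.e. classes. *)
Lemma slab_null (Z : set T) : measurable Z -> m Z = 0%E ->
  measurable (Z `*` setT `|` setT `*` Z) /\ mm (Z `*` setT `|` setT `*` Z) = 0%E.
Proof.
move=> mZ Z0.
have mZT : measurable (Z `*` [set: T]) by exact: measurableX.
have mTZ : measurable ([set: T] `*` Z) by exact: measurableX.
split; first exact: measurableU.
have E1 : mm (Z `*` setT) = 0%E.
  transitivity (m Z * m setT)%E; first exact: product_measure1E.
  by rewrite Z0 mul0e.
have E2 : mm (setT `*` Z) = 0%E.
  transitivity (m setT * m Z)%E; first exact: product_measure1E.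
  by rewrite Z0 mule0.
by transitivity (mm (Z `*` setT)) => //; exact: measureU0.
Qed.

(** The energy is an integral over D x R^N; since its density is symmetric, it controls
    the integral over all pairs that meet D.  This weight is at least 1 on such pairs, and 2 on
    D x D. *)
Definition touch (D : set T) (z : T * T) : R := \1_D z.1 + \1_D z.2.

Lemma touch_ge0 D z : 0 <= touch D z.
Proof. by rewrite addr_ge0// indicE ler0n. Qed.

Lemma touch_ge1 D z : D z.1 \/ D z.2 -> 1 <= touch D z.
Proof.
rewrite /touch !indicE => -[] Dz; rewrite (mem_set Dz).
  by rewrite lerDl ler0n.
by rewrite lerDr ler0n.
Qed.

(** The integral over R^N x D equals the one over D x R^N by symmetry. *)
Lemma integrable_touch (F : T * T -> R) (D : set T) : measurable D ->
  measurable_fun setT F -> (forall z, 0 <= F z) ->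
  (forall x y, F (x, y) = F (y, x)) ->
  (\int[mm]_(z in D `*` setT) (F z)%:E < +oo)%E ->
  mm.-integrable setT (EFin \o (fun z => touch D z * F z)).
Proof.
move=> mD mF F0 FC Foo.
have m1 : measurable_fun setT (fun z : T * T => \1_D z.1 : R).
  exact: (measurableT_comp (measurable_indic mD) measurable_fst).
have m2 : measurable_fun setT (fun z : T * T => \1_D z.2 : R).
  exact: (measurableT_comp (measurable_indic mD) measurable_snd).
have i1 : (\int[mm]_z (\1_D z.1 * F z)%:E < +oo)%E.
  apply: le_lt_trans Foo; rewrite [leRHS]integral_mkcond le_eqVlt.
  apply/orP; left; apply/eqP; apply: eq_integral => -[x y] _ /=.
  rewrite patchE indicE; case: ifPn => [|].
    by rewrite inE => -[/= /mem_set -> _]; rewrite mul1r.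
  rewrite notin_setE => xy; rewrite memNset ?mul0r//.
  by move=> Dx; apply: xy.
have i2 : (\int[mm]_z (\1_D z.2 * F z)%:E < +oo)%E.
  rewrite -(@ge0_integral_swap _ _ _ m (fun z => (\1_D z.2 * F z)%:E)).
  - apply: le_lt_trans i1; rewrite le_eqVlt; apply/orP; left; apply/eqP.
    by apply: eq_integral => -[x y] _ /=; rewrite FC.
  - by apply/measurable_EFinP; exact: measurable_funM.
  - by move=> z; rewrite lee_fin mulr_ge0// indicE ler0n.
apply: (eq_integrable _ ((EFin \o (fun z : T * T => \1_D z.1 * F z)) \+
                         (EFin \o (fun z : T * T => \1_D z.2 * F z)))) => //.
  by move=> z _ /=; rewrite -EFinD mulrDl.
by apply: integrableD => //; apply: ge0_integrable => //;
  [exact: measurable_funM|move=> z; rewrite mulr_ge0// indicE ler0n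
  |exact: measurable_funM|move=> z; rewrite mulr_ge0// indicE ler0n].
Qed.

(** Integrating first in the variable on which psi does not depend reduces this to
    the uniform bound on the sections of K. *)
Lemma integral_kernel_weight (K : T * T -> R) (psi : T -> R) (C : R) :
  0 <= C -> measurable_fun setT K -> (forall z, 0 <= K z) ->
  (forall x y, K (x, y) = K (y, x)) ->
  (forall x, (\int[m]_y (K (x, y))%:E <= C%:E)%E) ->
  measurable_fun setT psi -> (forall x, 0 <= psi x) ->
  (\int[mm]_z (K z * (psi z.1 + psi z.2))%:E <= (C + C)%:E * \int[m]_x (psi x)%:E)%E.
Proof.
move=> C0 mK K0 KC KintC mpsi psi0.
have mp1 : measurable_fun setT (fun z : T * T => psi z.1).
  exact: (measurableT_comp mpsi measurable_fst).
have mp2 : measurable_fun setT (fun z : T * T => psi z.2).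
  exact: (measurableT_comp mpsi measurable_snd).
have mKp1 : measurable_fun setT (fun z : T * T => (K z * psi z.1)%:E).
  by apply/measurable_EFinP; exact: measurable_funM.
have mKp2 : measurable_fun setT (fun z : T * T => (K z * psi z.2)%:E).
  by apply/measurable_EFinP; exact: measurable_funM.
have p1 (z : T * T) : (0 <= (K z * psi z.1)%:E)%E by rewrite lee_fin mulr_ge0.
have p2 (z : T * T) : (0 <= (K z * psi z.2)%:E)%E by rewrite lee_fin mulr_ge0.
have i1 : (\int[mm]_z (K z * psi z.1)%:E <= C%:E * \int[m]_x (psi x)%:E)%E.
  have mpsiE : measurable_fun setT (EFin \o psi) by exact/measurable_EFinP.
  rewrite (fubini_tonelli1 (fun z : T * T => (K z * psi z.1)%:E))//.
  rewrite -ge0_integralZl_EFin//; last by move=> ? _; rewrite lee_fin.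
  apply: ge0_le_integral => //.
  - by move=> ? _; apply: integral_ge0 => ? _.
  - exact: (measurable_fun_fubini_tonelli_F _ mKp1 p1).
  - exact: measurable_funeM.
  - move=> z _; rewrite /fubini_F/=; under eq_integral do rewrite mulrC EFinM.
    rewrite ge0_integralZl_EFin//.
    + by rewrite muleC lee_wpmul2r ?lee_fin.
    + by move=> ? _; rewrite lee_fin.
    + by apply/measurable_EFinP; exact: (measurableT_comp mK (pair1_measurable z)).
have i2 : (\int[mm]_z (K z * psi z.2)%:E <= C%:E * \int[m]_x (psi x)%:E)%E.
  rewrite -(@ge0_integral_swap _ _ _ m (fun z => (K z * psi z.2)%:E))//.
  apply: le_trans i1; rewrite le_eqVlt; apply/orP; left; apply/eqP.
  by apply: eq_integral => -[x y] _ /=; rewrite KC.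
under eq_integral do rewrite mulrDr EFinD.
rewrite ge0_integralD//.
by rewrite EFinD ge0_muleDl ?lee_fin//; exact: leeD.
Qed.

Lemma integral_tensor (A : set T) (psi : T -> R) : measurable A ->
  measurable_fun setT psi -> (forall x, 0 <= psi x) ->
  (\int[mm]_z (\1_A z.2 * psi z.1 + \1_A z.1 * psi z.2)%:E =
   m A * \int[m]_x (psi x)%:E + m A * \int[m]_x (psi x)%:E)%E.
Proof.
move=> mA mpsi psi0.
have mA1 : measurable_fun setT (fun z : T * T => \1_A z.1 : R).
  exact: (measurableT_comp (measurable_indic mA) measurable_fst).
have mA2 : measurable_fun setT (fun z : T * T => \1_A z.2 : R).
  exact: (measurableT_comp (measurable_indic mA) measurable_snd).
have mp1 : measurable_fun setT (fun z : T * T => psi z.1).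
  exact: (measurableT_comp mpsi measurable_fst).
have mp2 : measurable_fun setT (fun z : T * T => psi z.2).
  exact: (measurableT_comp mpsi measurable_snd).
have m1 : measurable_fun setT (fun z : T * T => (\1_A z.2 * psi z.1)%:E).
  by apply/measurable_EFinP; exact: measurable_funM.
have m2 : measurable_fun setT (fun z : T * T => (\1_A z.1 * psi z.2)%:E).
  by apply/measurable_EFinP; exact: measurable_funM.
have p1 (z : T * T) : (0 <= (\1_A z.2 * psi z.1)%:E)%E.
  by rewrite lee_fin mulr_ge0// indicE.
have p2 (z : T * T) : (0 <= (\1_A z.1 * psi z.2)%:E)%E.
  by rewrite lee_fin mulr_ge0// indicE.
have i1 : (\int[mm]_z (\1_A z.2 * psi z.1)%:E = m A * \int[m]_x (psi x)%:E)%E.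
  have mpsiE : measurable_fun setT (EFin \o psi) by exact/measurable_EFinP.
  rewrite (fubini_tonelli1 (fun z : T * T => (\1_A z.2 * psi z.1)%:E))//.
  rewrite -ge0_integralZl//; last by move=> ? _; rewrite lee_fin.
  apply: eq_integral => x _; rewrite /fubini_F/=.
  under eq_integral do rewrite mulrC EFinM.
  rewrite ge0_integralZl_EFin//; last by apply/measurable_EFinP; exact: measurable_indic.
  by rewrite integral_indic// setIT muleC.
under eq_integral do rewrite EFinD.
rewrite ge0_integralD//; congr (_ + _)%E; rewrite ?i1//.
rewrite -i1 -[RHS](@ge0_integral_swap _ _ _ m (fun z => (\1_A z.2 * psi z.1)%:E))//.
Qed.

End double_integrals.

(** * Weak forms *)

Section forms.
Context {R : realType} {N : nat}.
Variables (s p : R) (D : set 'rV[R]_N).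
Hypotheses (s0 : 0 < s) (p1 : 1 < p) (mD : measurable D).
Local Notation rV := 'rV[R]_N.
Local Notation mu := (rV_lebesgue R N).
Local Notation h := (signed_pow p).
Implicit Types (u v w q phi : rV -> R) (z : rV * rV).

Lemma measurable_signed_pow : measurable_fun setT h.
Proof.
apply: measurable_funM; last exact: measurable_id.
apply: (measurableT_comp (measurable_powR _)).
exact: (@normr_measurable R setT).
Qed.

Lemma measurable_Lp_on A r u : measurable A -> Lp_on A r u -> measurable_fun A u.
Proof.
move=> mA; rewrite /Lp_on /= => /andP[+ _]; rewrite inE/= => mf.
exact/(measurable_restrictT _ mA).
Qed.

Lemma measurable_Lp_loc r u : Lp_loc r u -> measurable_fun setT u.
Proof.
move=> ul; pose B n : set rV := [set y | `|0 - y| <= n%:R].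
have -> : [set: rV] = \bigcup_n B n.
  apply/seteqP; split => // x _; exists (Num.truncn `|x|).+1 => //.
  by rewrite /B/= sub0r normrN ltW// truncnS_gt.
apply/measurable_fun_bigcup => [n|n]; first exact: measurable_cube.
by apply: (measurable_Lp_on _ (ul (B n) _)); [exact: measurable_cube|exact: compact_cube].
Qed.

Lemma integrable_Lp_on A u : Lp_on A p%:E u ->
  mu.-integrable setT (EFin \o (fun x => `|(u \_ A) x| `^ p)).
Proof. by move=> uA; apply: (Lfun_integrable (ltW p1)). Qed.

(** On a null space the norm at infinity is zero by convention, which is the
    second case. *)
Lemma ae_bounded_Lp_on A u : Lp_on A +oo%E u ->
  exists2 L, 0 <= L & {ae mu, forall x, A x -> `|u x| <= L}.
Proof.
rewrite /Lp_on /= => /andP[_]; rewrite inE/= /finite_norm unlock.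
case: ifPn => [_ uoo|mu0 _]; last first.
  exists 0 => //; exists setT; split => //.
  by apply/eqP; rewrite eq_le measure_ge0 andbT leNgt.
have [L LP] := ess_supr_bounded (f := fun x => `|(u \_ A) x|) uoo.
exists (Num.max 0 L); first by rewrite le_max lexx.
apply: filterS LP => x; rewrite patchE => uL Ax; rewrite mem_set// in uL.
by rewrite le_max uL orbT.
Qed.

Definition nl_density u z : R := `|u z.1 - u z.2| `^ p / nl_kernel s p z.

Lemma nl_density_ge0 u z : 0 <= nl_density u z.
Proof. by rewrite divr_ge0 ?powR_ge0. Qed.

Lemma nl_densityC u x y : nl_density u (x, y) = nl_density u (y, x).
Proof. by rewrite /nl_density/= distrC nl_kernelC. Qed.

Lemma measurable_diff u : measurable_fun setT u ->
  measurable_fun setT (fun z => u z.1 - u z.2).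
Proof.
move=> mu_; apply: measurable_funB.
  exact: (measurableT_comp mu_ measurable_fst).
exact: (measurableT_comp mu_ measurable_snd).
Qed.

Lemma measurable_nl_density u : measurable_fun setT u ->
  measurable_fun setT (nl_density u).
Proof.
move=> mf; apply: measurable_funM; last exact: measurable_nl_kernelV.
apply: (measurableT_comp (measurable_powR _)).
exact: (measurableT_comp (@normr_measurable R setT) (measurable_diff mf)).
Qed.

Definition form_density v w phi z : R :=
  (h (v z.1 - v z.2) - h (w z.1 - w z.2)) * (phi z.1 - phi z.2) / nl_kernel s p z.

(** Off a null set phi is supported in D, so the integrand vanishes unless the pair
    meets D, and there it is dominated by the sum of the two energy densities. *)
Lemma integrable_form v phi :
  measurable_fun setT v -> (nl_energy s p D v < +oo)%E ->
  measurable_fun setT phi -> (nl_energy s p setT phi < +oo)%E ->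
  {ae mu, forall x, ~ D x -> phi x = 0} ->
  (mu \x mu)%E.-integrable setT
    (EFin \o (fun z => h (v z.1 - v z.2) * (phi z.1 - phi z.2) / nl_kernel s p z)).
Proof.
move=> mv voo mphi phioo [Z [mZ Z0 phiZ]].
have [mS S0] := slab_null mZ Z0.
have iv := integrable_touch mD (measurable_nl_density mv) (nl_density_ge0 v)
  (nl_densityC v) voo.
have iphi : (mu \x mu)%E.-integrable setT (EFin \o nl_density phi).
  apply: ge0_integrable; [exact: measurable_nl_density|exact: nl_density_ge0|].
  by move: phioo; rewrite /nl_energy setXTT.
apply: (ae_le_integrable measurableT mS S0
  (g := fun z => touch D z * nl_density v z + nl_density phi z)).
- apply: measurable_funM; last exact: measurable_nl_kernelV.
  apply: measurable_funM; last exact: measurable_diff.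
  exact: (measurableT_comp measurable_signed_pow (measurable_diff mv)).
- move=> [x y] _ /= Sxy; rewrite normrM (ger0_norm (nl_kernelV_ge0 _ _ _)).
  have Zx : ~ Z x by move=> Zx; apply: Sxy; left.
  have Zy : ~ Z y by move=> Zy; apply: Sxy; right.
  have [DD|/not_orP[Dx Dy]] := pselect (D x \/ D y); last first.
    have -> : phi x = 0 by apply: contrapT => phx; apply/Zx/phiZ => /(_ Dx).
    have -> : phi y = 0 by apply: contrapT => phy; apply/Zy/phiZ => /(_ Dy).
    rewrite subrr mulr0 normr0 mul0r; apply: addr_ge0; last exact: nl_density_ge0.
    by apply: mulr_ge0; [exact: touch_ge0|exact: nl_density_ge0].
  apply: (@le_trans _ _ (nl_density v (x, y) + nl_density phi (x, y))).
    rewrite -mulrDl; apply: ler_wpM2r; first exact: nl_kernelV_ge0.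
    exact: signed_pow_young.
  rewrite lerD2r ler_peMl ?nl_density_ge0//.
  exact: touch_ge1.
- by have := integrableD measurableT iv iphi; apply: eq_integrable.
Qed.

(** Off a null set phi vanishes outside K, and v is p-integrable on K. *)
Lemma integrable_potential q v phi (Q : R) : 0 <= Q ->
  measurable_fun D q -> {ae mu, forall x, D x -> `|q x| <= Q} ->
  Lp_loc p%:E v -> Lp_on setT p%:E phi ->
  (exists2 K, compact K & {ae mu, forall x, ~ K x -> phi x = 0}) ->
  mu.-integrable D (EFin \o (fun x => q x * h (v x) * phi x)).
Proof.
move=> Q0 mq [Zq [mZq Zq0 qZ]] vl phil [K Kc [Z [mZ Z0 phiZ]]].
have mv := measurable_Lp_loc vl.
have mphi := measurable_Lp_on measurableT phil.
have iv := integrable_Lp_on (vl K Kc); have iphi := integrable_Lp_on phil.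
have mU : measurable (Zq `|` Z) by exact: measurableU.
have U0 : mu (Zq `|` Z) = 0%E by rewrite measureU0.
apply: (ae_le_integrable mD mU U0
  (g := fun x => Q * (`|(v \_ K) x| `^ p + `|(phi \_ setT) x| `^ p))).
- apply: measurable_funM; last exact: measurable_funTS.
  apply: measurable_funM => //; apply: measurable_funTS.
  exact: (measurableT_comp measurable_signed_pow mv).
- move=> x Dx Ux.
  have qx : `|q x| <= Q.
    by apply: contrapT => qx; apply: Ux; left; apply: qZ => /(_ Dx).
  have [Kx|nKx] := pselect (K x); last first.
    have -> : phi x = 0.
      by apply: contrapT => px; apply: Ux; right; apply: phiZ => /(_ nKx).
    by rewrite mulr0 normr0 mulr_ge0// addr_ge0 ?powR_ge0.
  rewrite -mulrA normrM; apply: ler_pM => //.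
  by rewrite !patchE mem_set// in_setT; exact: signed_pow_young.
- apply: (integrableS measurableT mD) => //.
  have := integrableZl measurableT Q (integrableD measurableT iv iphi).
  apply: eq_integrable => // x _ /=; by rewrite -EFinD -EFinM.
Qed.

Definition potential_density q v w phi x : R :=
  q x * (h (v x) - h (w x)) * phi x.

(** The supersolution inequality for v minus the subsolution inequality for w.  The
    source term has cancelled, and integrability is recorded because the integral
    of a nonintegrable function carries no information. *)
Definition ordered_forms q v w : Prop := forall phi, test_function s p D phi ->
  [/\ (mu \x mu)%E.-integrable setT (EFin \o form_density v w phi),
      mu.-integrable D (EFin \o potential_density q v w phi) &
      (0 <= \int[mu \x mu]_z (form_density v w phi z)%:E +
            \int[mu]_(x in D) (potential_density q v w phi x)%:E)%E].

(** Since h is odd, both densities are left unchanged. *)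
Lemma ordered_formsN q v w : ordered_forms q v w ->
  ordered_forms q (fun x => - w x) (fun x => - v x).
Proof.
move=> H phi /H.
have -> : form_density (fun x => - w x) (fun x => - v x) phi = form_density v w phi.
  apply/funext => z; rewrite /form_density; congr (_ * _ / _).
  rewrite -!opprD.
  by rewrite !signed_powN addrC opprK.
have -> : potential_density q (fun x => - w x) (fun x => - v x) phi =
    potential_density q v w phi.
  by apply/funext => x; rewrite /potential_density !signed_powN opprK addrC.
by [].
Qed.

Lemma ordered_forms_sol q g v w :
  Lp_on D +oo%E q -> supersolution s p D q g v -> subsolution s p D q g w ->
  ordered_forms q v w.
Proof.
move=> qD [[vl voo] vsup] [[wl woo] wsub] phi tphi.
have mq := measurable_Lp_on mD qD.
have [Q Q0 qQ] := ae_bounded_Lp_on qD.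
have [[[phiL phioo] phi0] _ phiK] := tphi.
have mphi := measurable_Lp_on measurableT phiL.
have iv := integrable_form (measurable_Lp_loc vl) voo mphi phioo phi0.
have iw := integrable_form (measurable_Lp_loc wl) woo mphi phioo phi0.
have jv := integrable_potential Q0 mq qQ vl phiL phiK.
have jw := integrable_potential Q0 mq qQ wl phiL phiK.
have formE z : form_density v w phi z =
    h (v z.1 - v z.2) * (phi z.1 - phi z.2) / nl_kernel s p z -
    h (w z.1 - w z.2) * (phi z.1 - phi z.2) / nl_kernel s p z.
  by rewrite /form_density !mulrBl.
have potE x : potential_density q v w phi x =
    q x * h (v x) * phi x - q x * h (w x) * phi x.
  by rewrite /potential_density mulrBr mulrBl.
split.
- have := integrableB measurableT iv iw; apply: eq_integrable => // z _ /=.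
  by rewrite formE EFinB.
- have := integrableB mD jv jw; apply: eq_integrable => // x _ /=.
  by rewrite potE EFinB.
have le_wv := le_trans (wsub phi tphi) (vsup phi tphi).
under eq_integral do rewrite formE EFinB.
under [X in (0 <= _ + X)%E]eq_integral do rewrite potE EFinB.
rewrite (integralB_EFin measurableT iv iw) (integralB_EFin mD jv jw).
move: le_wv; rewrite /weak_form.
have := integrable_fin_num measurableT iv; have := integrable_fin_num measurableT iw.
have := integrable_fin_num mD jv; have := integrable_fin_num mD jw.
rewrite /comp.
move: (integral _ _ _) => jw'.
move: (integral _ _ (fun x => (q x * h (v x) * phi x)%:E)) => jv'.
move: (integral _ _ _) => iw'.
move: (integral _ _ _) => iv'.
move=> /fineK <- /fineK <- /fineK <- /fineK <-.
by rewrite -!EFinB -!EFinD !lee_fin; lra.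
Qed.

End forms.

(** * The excess of the barrier over v as a test function *)

Section local_comparison.
Context {R : realType} {N : nat}.
Variables (s p : R) (D : set 'rV[R]_N).
Hypotheses (s0 : 0 < s) (s1 : s < 1) (p1 : 1 < p) (mD : measurable D).
Local Notation rV := 'rV[R]_N.
Local Notation mu := (rV_lebesgue R N).
Local Notation h := (signed_pow p).
Implicit Types (u v w q phi : rV -> R) (z : rV * rV).

Let p0 : 0 < p. Proof. exact: lt_trans ltr01 p1. Qed.
Let sp0 : 0 < s * p. Proof. exact: mulr_gt0. Qed.
Let spp : s * p < p. Proof. by rewrite gtr_pMl. Qed.

Local Notation rho g := (fun z : rV * rV => trunc_kernel (N := N) g (s * p) `|z.1 - z.2|).

Lemma measurable_trunc_kernelB g : measurable_fun setT (rho g).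
Proof. exact: (measurableT_comp (measurable_trunc_kernel _ _) measurable_normB). Qed.

(** The density is at most a multiple of the truncated kernel with exponent p > sp,
    and it vanishes unless the pair meets the support of the tent. *)
Lemma tent_energy_fin (x0 : rV) (r : R) : 0 < r ->
  (mu \x mu)%E.-integrable setT (EFin \o nl_density s p (tent x0 r)).
Proof.
move=> r0; pose B : set rV := [set y | `|x0 - y| <= r].
have mB : measurable B by exact: measurable_cube.
have intB : (\int[mu]_y (\1_B y)%:E = ((2 * r) ^+ N)%:E)%E.
  by rewrite integral_indic// setIT; exact: lebesgue_cube (ltW r0).
have [C C0 HC] := integral_trunc_kernel (N := N) sp0 spp.
have mt := measurable_tent x0 r.
pose c := 1 + r^-1 `^ p.
have c0 : 0 <= c by rewrite addr_ge0// powR_ge0.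
have wt z : 0 <= \1_B z.1 + \1_B z.2 :> R by exact: (touch_ge0 B z).
have m1 : measurable_fun setT (fun z : rV * rV => \1_B z.1 + \1_B z.2 : R).
  apply: measurable_funD.
    exact: (measurableT_comp (measurable_indic mB) measurable_fst).
  exact: (measurableT_comp (measurable_indic mB) measurable_snd).
have iK : (mu \x mu)%E.-integrable setT
    (EFin \o (fun z => rho p z * (\1_B z.1 + \1_B z.2))).
  apply: ge0_integrable.
  - by apply: measurable_funM => //; exact: measurable_trunc_kernelB.
  - by move=> z; rewrite mulr_ge0// trunc_kernel_ge0.
  apply: (le_lt_trans (integral_kernel_weight (K := rho p) (psi := \1_B) C0 _ _ _ _ _ _)).
  - exact: measurable_trunc_kernelB.
  - by move=> z; exact: trunc_kernel_ge0.
  - by move=> x y /=; rewrite distrC.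
  - exact: HC.
  - exact: measurable_indic.
  - by move=> x; rewrite indicE ler0n.
  - by rewrite intB -EFinM ltry.
apply: (ae_le_integrable measurableT measurable0 (measure0 _)
  (g := fun z => c * (rho p z * (\1_B z.1 + \1_B z.2)))).
- exact: measurable_nl_density.
- move=> [x y] _ _; rewrite ger0_norm ?nl_density_ge0//.
  have [BB|/not_orP[Bx By]] := pselect (B x \/ B y); last first.
    have tx : tent x0 r x = 0 by apply: tent_eq0 => //; rewrite leNgt; apply/negP => /ltW.
    have ty : tent x0 r y = 0 by apply: tent_eq0 => //; rewrite leNgt; apply/negP => /ltW.
    rewrite /nl_density/= tx ty subrr normr0 powR0 ?gt_eqF// mul0r.
    by rewrite !mulr_ge0 ?trunc_kernel_ge0//; exact: (wt (x, y)).
  apply: (@le_trans _ _ (c * rho p (x, y))); last first.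
    apply: ler_wpM2l => //; rewrite ler_peMr ?trunc_kernel_ge0//.
    exact: (@touch_ge1 _ _ R B (x, y) BB).
  rewrite /nl_density/trunc_kernel mulrA; apply: ler_pM.
  - exact: powR_ge0.
  - exact: nl_kernelV_ge0.
  - apply: le_trans (min_powR_scale p0 r0 (normr_ge0 _)).
    apply: ge0_ler_powR; rewrite ?nnegrE ?(ltW p0) ?tent_lipschitz//.
    by rewrite le_min ler01 divr_ge0// ltW.
  - exact: nl_kernelV_le.
- have := integrableZl measurableT c iK; apply: eq_integrable => // z _ /=.
Qed.

(** The positive part (a f - u)^+; the inner maximum only matters on the null set
    where u < 0, and makes 0 <= phi <= a f hold everywhere. *)
Definition barrier_excess (x0 : rV) (r a : R) v w x : R :=
  Num.max 0 (a * tent x0 r x - Num.max 0 (v x - w x)).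

Section barrier_excess.
Variables (x0 : rV) (r a : R) (v w : rV -> R).
Hypotheses (r0 : 0 < r) (a0 : 0 <= a) (a1 : a <= 1).
Local Notation phi := (barrier_excess x0 r a v w).

Lemma barrier_excess_ge0 x : 0 <= phi x.
Proof. by rewrite le_max lexx. Qed.

Lemma barrier_excess_le x : phi x <= a * tent x0 r x.
Proof.
rewrite ge_max mulr_ge0 ?tent_ge0//= gerBl.
by rewrite le_max lexx.
Qed.

Lemma barrier_excess_le1 x : phi x <= 1.
Proof.
apply: (le_trans (barrier_excess_le x)); rewrite -[leRHS]mulr1.
by apply: ler_pM; rewrite ?tent_ge0 ?tent_le1.
Qed.

Lemma barrier_excess_eq0 x : r <= `|x0 - x| -> phi x = 0.
Proof.
move=> xr; apply/eqP; rewrite eq_le barrier_excess_ge0 andbT.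
by rewrite (le_trans (barrier_excess_le x))// tent_eq0// mulr0.
Qed.

Lemma barrier_excess_gt0 x : 0 < phi x ->
  `|x0 - x| < r /\ v x - w x < a.
Proof.
move=> px; split.
  by rewrite ltNge; apply/negP => /barrier_excess_eq0 E; rewrite E ltxx in px.
move: px; rewrite lt_max ltxx/= subr_gt0 gt_max => /andP[_] /lt_le_trans; apply.
by rewrite -[leRHS]mulr1 ler_wpM2l// tent_le1.
Qed.

(** Positive parts are 1-Lipschitz, so the energy of phi is controlled by those of v,
    w and the tent. *)
Lemma barrier_excess_diff x y :
  `|phi x - phi y| <= `|v x - v y| + `|w x - w y| + `|tent x0 r x - tent x0 r y|.
Proof.
have lipmax (b c : R) : `|Num.max 0 b - Num.max 0 c| <= `|b - c|.
  by case: (leP 0 b) => hb; case: (leP 0 c) => hc; rewrite ler_norml;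
    have := ler_norm (b - c); have := ler_norm (- (b - c)); rewrite normrN; lra.
apply: (le_trans (lipmax _ _)).
have -> (t t' m m' : R) : a * t - m - (a * t' - m') = a * (t - t') - (m - m') by ring.
apply: (le_trans (ler_normB _ _)); rewrite addrC; apply: lerD.
  apply: (le_trans (lipmax _ _)).
  have -> : v x - w x - (v y - w y) = v x - v y - (w x - w y) by ring.
  exact: ler_normB.
by rewrite normrM (ger0_norm a0) ler_piMl.
Qed.

Hypotheses (mv : measurable_fun setT v) (mw : measurable_fun setT w).

Lemma measurable_barrier_excess : measurable_fun setT phi.
Proof.
apply: measurable_maxr; first exact: measurable_cst.
apply: measurable_funB.
  by apply: measurable_funM; [exact: measurable_cst|exact: measurable_tent].
apply: measurable_maxr; first exact: measurable_cst.
exact: measurable_funB.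
Qed.

Hypotheses (voo : (nl_energy s p D v < +oo)%E) (woo : (nl_energy s p D w < +oo)%E).
Hypothesis BD : forall x, `|x0 - x| <= r -> D x.

Lemma integrable_barrier_excess : mu.-integrable setT (EFin \o phi).
Proof.
pose B : set rV := [set y | `|x0 - y| <= r].
have mB : measurable B by exact: measurable_cube.
have intB : (\int[mu]_y (\1_B y)%:E = ((2 * r) ^+ N)%:E)%E.
  by rewrite integral_indic// setIT; exact: lebesgue_cube (ltW r0).
apply: (ae_le_integrable measurableT measurable0 (measure0 _) (g := \1_B)).
- exact: measurable_barrier_excess.
- move=> x _ _; rewrite ger0_norm ?barrier_excess_ge0// indicE.
  have [Bx|nBx] := pselect (B x); first by rewrite mem_set// barrier_excess_le1.
  by rewrite memNset// barrier_excess_eq0// leNgt; apply/negP => /ltW.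
- apply: ge0_integrable; [exact: measurable_indic|by move=> x; rewrite indicE|].
  by rewrite intB ltry.
Qed.

Lemma test_function_barrier_excess : test_function s p D phi.
Proof.
have phiNB x : ~ `|x0 - x| <= r -> phi x = 0.
  by move=> nBx; rewrite barrier_excess_eq0// leNgt; apply/negP => /ltW.
have mphi := measurable_barrier_excess.
have iphi := integrable_barrier_excess.
split; last 2 first.
- by apply: aeW => x; exact: barrier_excess_ge0.
- exists [set y | `|x0 - y| <= r]; first exact: compact_cube.
  by apply: aeW => x; exact: phiNB.
split; last by apply: aeW => x nDx; apply: phiNB => /BD.
split.
- rewrite /Lp_on /= patch_setT; apply/andP; split; first by rewrite inE.
  rewrite inE/= /finite_norm unlock; apply: poweR_lty.
  have /integrableP[_] := iphi; apply: le_lt_trans.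
  apply: ge0_le_integral => //.
  - by move=> x _; rewrite lee_fin powR_ge0.
  - apply/measurable_EFinP; apply: (measurableT_comp (measurable_powR _)).
    exact: (measurableT_comp (@normr_measurable R setT) mphi).
  - by apply/measurable_EFinP; exact: (measurableT_comp (@normr_measurable R setT) mphi).
  move=> x _ /=; rewrite lee_fin ger0_norm ?barrier_excess_ge0//.
  have := barrier_excess_ge0 x; rewrite le_eqVlt => /predU1P[<-|px].
    by rewrite powR0// gt_eqF.
  by apply: ge1r_powR; rewrite ?px ?barrier_excess_le1// ltW.
have iv := integrable_touch mD (measurable_nl_density _ _ mv) (nl_density_ge0 s p v)
  (nl_densityC s p v) voo.
have iw := integrable_touch mD (measurable_nl_density _ _ mw) (nl_density_ge0 s p w)
  (nl_densityC s p w) woo.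
have it := tent_energy_fin x0 r0.
have idom := integrableZl measurableT (3 `^ p)
  (integrableD measurableT (integrableD measurableT iv iw) it).
have idphi : (mu \x mu)%E.-integrable setT (EFin \o nl_density s p phi).
  apply: (ae_le_integrable measurableT measurable0 (measure0 _)
    (g := fun z => 3 `^ p * (touch D z * nl_density s p v z +
      touch D z * nl_density s p w z + nl_density s p (tent x0 r) z))).
  - exact: measurable_nl_density.
  - move=> [x y] _ _; rewrite ger0_norm ?nl_density_ge0//.
    have [DD|/not_orP[Dx Dy]] := pselect (D x \/ D y); last first.
      rewrite /(nl_density _ _ phi)/nl_density/= (phiNB x) ?(phiNB y); try by move=> /BD.
      rewrite subrr normr0 powR0 ?gt_eqF// mul0r mulr_ge0 ?powR_ge0//.
      by rewrite !addr_ge0 ?mulr_ge0 ?touch_ge0 ?invr_ge0 ?powR_ge0.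
    apply: (@le_trans _ _ (3 `^ p * (nl_density s p v (x, y) + nl_density s p w (x, y) +
        nl_density s p (tent x0 r) (x, y)))).
      rewrite /nl_density -!mulrDl mulrA; apply: ler_wpM2r; first exact: nl_kernelV_ge0.
      apply: le_trans (powR_sum3 p1 _ _ _) => //.
      by apply: ge0_ler_powR; rewrite ?nnegrE ?addr_ge0 ?(ltW p0)//; exact: barrier_excess_diff.
    apply: ler_wpM2l; first exact: powR_ge0.
    by rewrite lerD2r; apply: lerD; rewrite ler_peMl ?nl_density_ge0//; exact: touch_ge1.
  - move: idom; apply: eq_integrable => // z _ /=.
rewrite /nl_energy setXTT.
have /integrableP[_] := idphi; apply: le_lt_trans.
rewrite le_eqVlt; apply/orP; left; apply/eqP; apply: eq_integral => z _ /=.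
by rewrite (ger0_norm (nl_density_ge0 s p phi z)).
Qed.

End barrier_excess.

(** * Comparison with the barrier in a ball *)

Lemma small_power (th K b e : R) : 0 < th -> 0 <= K -> 0 < b -> 0 < e ->
  exists a, [/\ 0 < a, a <= 1, a <= e & K * a `^ th < b].
Proof.
move=> th0 K0 b0 e0; have K1 : 0 < K + 1 by rewrite ltr_wpDl.
pose t := (b / (K + 1)) `^ th^-1.
have t0 : 0 < t by rewrite powR_gt0// divr_gt0.
exists (Num.min 1 (Num.min e t)); split.
- by rewrite !lt_min ltr01 e0.
- by rewrite ge_min lexx.
- by rewrite !ge_min lexx orbT.
apply: (@le_lt_trans _ _ (K * t `^ th)).
  apply: ler_wpM2l => //; apply: ge0_ler_powR; rewrite ?nnegrE ?(ltW t0) ?(ltW th0)//.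
    by rewrite !le_min ler01 !ltW.
  by rewrite !ge_min lexx !orbT.
rewrite /t -powRrM mulVf ?gt_eqF// powRr1 ?divr_ge0 ?(ltW b0) ?(ltW K1)//.
rewrite mulrA ltr_pdivrMr// mulrC ltr_pM2l//; lra.
Qed.

Section barrier.
Variables (v w : rV -> R) (x0 : rV) (r L e C g th c0 : R) (Z M : set rV).
Variables (rho0 : R).
Hypotheses (r0 : 0 < r) (e0 : 0 < e) (C0 : 0 <= C) (N0 : (0 < N)%N).
Hypothesis wv : forall x, ~ Z x -> w x <= v x.
Hypothesis wL : forall x, ~ Z x -> `|w x| <= L.
Hypothesis Mfar : forall y, M y -> 2 * r <= `|x0 - y|.
Hypothesis Mbnd : forall y, M y -> `|x0 - y| <= rho0.
Hypothesis Mgap : forall y, M y -> ~ Z y -> 4 * e <= v y - w y.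
Hypothesis gap : forall t, `|t| <= L + L -> c0 <= h t - h (t - (e + e)).
Hypothesis c00 : 0 < c0.
Hypothesis grow : forall (a : R) x y, 0 <= a -> a <= 1 -> ~ Z x -> ~ Z y -> `|x0 - x| <= r ->
  `|h (w x - w y + a * (tent x0 r x - tent x0 r y)) - h (w x - w y)| <=
  C * a `^ th * Num.min (`|x - y| `^ g) 1.

Let W (a : R) (u : rV) := w u + a * tent x0 r u + 4 * e * \1_M u.

Let c := c0 * (N%:R * (r + rho0)) `^ (- (N%:R + s * p)).

(** The two effects compete here.  If y is not in M, only the tent contributes
    and grow applies.  If y is in M, raising w by 4e at y beats the tent, which adds at most
    2e at x, and the gain is at least c0 k(x,y) >= c. *)
Lemma barrier_increment (a : R) x y : 0 <= a -> a <= 1 -> a <= e + e ->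
  ~ Z x -> ~ Z y -> `|x0 - x| <= r ->
  (h (W a x - W a y) - h (w x - w y)) * (nl_kernel s p (x, y))^-1 <=
  C * a `^ th * trunc_kernel (N := N) g (s * p) `|x - y| - c * \1_M y.
Proof.
move=> a0 a1 ae Zx Zy xr.
have k0 := nl_kernelV_ge0 s p (x, y).
have E0 : 0 <= C * a `^ th by rewrite mulr_ge0 ?powR_ge0.
have nMx : ~ M x by move=> /Mfar; have := r0; lra.
have Wx : W a x = w x + a * tent x0 r x by rewrite /W indicE memNset// mulr0 addr0.
have [My|nMy] := pselect (M y); last first.
  rewrite [X in _ - c * X]indicE (memNset nMy) mulr0 subr0.
  have -> : W a x - W a y = w x - w y + a * (tent x0 r x - tent x0 r y).
    by rewrite Wx /W indicE (memNset nMy) mulr0; ring.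
  apply: (@le_trans _ _ (C * a `^ th * Num.min (`|x - y| `^ g) 1 *
                         (nl_kernel s p (x, y))^-1)).
    by apply: ler_wpM2r => //; rewrite (le_trans (ler_norm _))// grow.
  rewrite /trunc_kernel mulrA; apply: ler_wpM2l; last exact: nl_kernelV_le.
  by rewrite mulr_ge0// le_min powR_ge0 ler01.
have ty : tent x0 r y = 0 by apply: tent_eq0 => //; have := Mfar My; have := r0; lra.
rewrite [X in _ - c * X]indicE (mem_set My) mulr1.
have atx : a * tent x0 r x <= e + e.
  by apply: le_trans ae; rewrite -[leRHS]mulr1 ler_wpM2l// tent_le1.
have hW : h (W a x - W a y) <= h (w x - w y - (e + e)).
  apply: le_signed_pow => //; rewrite Wx /W indicE (mem_set My) ty mulr1 mulr0; lra.
have tL : `|w x - w y| <= L + L.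
  by rewrite (le_trans (ler_normB _ _))// lerD// wL.
have xy0 : 0 < `|x - y|.
  have := ler_distD x x0 y; have := Mfar My; have := r0; rewrite distrC; lra.
have xyb : `|x - y| <= r + rho0.
  have := ler_distD x0 x y; have := Mbnd My; rewrite (distrC x x0); lra.
have kge := nl_kernelV_ge s0 p1 N0 (z := (x, y)) xy0 xyb.
apply: (@le_trans _ _ (- c0 * (nl_kernel s p (x, y))^-1)).
  by apply: ler_wpM2r => //; have := gap tL; have := c00; lra.
apply: (@le_trans _ _ (- c)).
  by rewrite mulNr lerN2 /c ler_wpM2l// ltW.
by rewrite lerDr mulr_ge0// trunc_kernel_ge0.
Qed.

Lemma barrier_integrand (a : R) phi x y : phi = barrier_excess x0 r a v w ->
  0 <= a -> a <= 1 -> a <= e + e -> ~ Z x -> ~ Z y ->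
  form_density s p v w phi (x, y) <=
  C * a `^ th * (trunc_kernel (N := N) g (s * p) `|x - y| * (phi x + phi y)) -
  c * (\1_M y * phi x + \1_M x * phi y).
Proof.
move=> phiD a0 a1 ae Zx Zy.
have phiE (u : rV) : ~ Z u -> phi u = Num.max 0 (W a u - v u).
  move=> Zu; have u0 : 0 <= v u - w u by rewrite subr_ge0 wv.
  have [Mu|nMu] := pselect (M u).
    have tu : tent x0 r u = 0 by apply: tent_eq0 => //; have := Mfar Mu; have := r0; lra.
    rewrite phiD barrier_excess_eq0//; last by have := Mfar Mu; have := r0; lra.
    rewrite max_l// /W tu indicE mem_set// mulr1 mulr0.
    by have := Mgap Mu Zu; lra.
  rewrite phiD /barrier_excess (max_r u0) /W indicE memNset// mulr0.
  by congr Num.max; ring.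
apply: (le_trans (comparison_integrand_le p1 (wx := w x) (wy := w y)
  (Gx := C * a `^ th * trunc_kernel (N := N) g (s * p) `|x - y| - c * \1_M y)
  (Gy := C * a `^ th * trunc_kernel (N := N) g (s * p) `|x - y| - c * \1_M x)
  (nl_kernelV_ge0 s p (x, y)) (phiE x Zx) (phiE y Zy) _ _)).
- rewrite phiD => px; have [xr _] := barrier_excess_gt0 r0 a0 px.
  by apply: barrier_increment => //; exact: ltW.
- rewrite phiD => py; have [yr _] := barrier_excess_gt0 r0 a0 py.
  by rewrite nl_kernelC distrC; apply: barrier_increment => //; exact: ltW.
by rewrite le_eqVlt; apply/orP; left; apply/eqP; ring.
Qed.

End barrier.

(** The constants c0, C and the integral of the kernel do not depend on a, so a can be
    taken so small that the cost C a^th (2 Crho + Q) of the tent, where Q accounts for the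
    zeroth order term, is less than the gain 2 c mu(M).  The tested inequality then forces
    the integral of phi to vanish. *)
Lemma strong_comparison_ball (v w q : rV -> R) (x0 : rV) (r L e C g th rho0 Q : R)
    (Z M : set rV) :
  (0 < N)%N -> 0 < r -> 0 <= L -> 0 < e -> 0 <= C -> s * p < g -> 0 < th -> 0 <= Q ->
  measurable Z -> mu Z = 0%E -> measurable_fun setT v -> measurable_fun setT w ->
  (nl_energy s p D v < +oo)%E -> (nl_energy s p D w < +oo)%E ->
  ordered_forms s p D q v w ->
  (forall x, `|x0 - x| <= r -> D x) ->
  (forall x, ~ Z x -> w x <= v x) ->
  (forall x, ~ Z x -> `|w x| <= L) ->
  (forall x, ~ Z x -> D x -> q x <= Q) ->
  measurable M -> (0 < mu M)%E ->
  (forall y, M y -> 2 * r <= `|x0 - y|) -> (forall y, M y -> `|x0 - y| <= rho0) ->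
  (forall y, M y -> ~ Z y -> 4 * e <= v y - w y) ->
  (forall (a : R) x y, 0 <= a -> a <= 1 -> ~ Z x -> ~ Z y -> `|x0 - x| <= r ->
    `|h (w x - w y + a * (tent x0 r x - tent x0 r y)) - h (w x - w y)| <=
    C * a `^ th * Num.min (`|x - y| `^ g) 1) ->
  (forall a t : R, 0 <= a -> a <= 1 -> `|t| <= L -> `|h (t + a) - h t| <= C * a `^ th) ->
  exists2 b, 0 < b & {ae mu, forall x, `|x0 - x| <= r / 2 -> b <= v x - w x}.
Proof.
move=> N0 r0 L0 e0 C0 spg th0 Q0 mZ Z0 mv mw voo woo vw BD wv wL qQ.
move=> mM M0 Mfar Mbnd Mgap grow pot.
have [c0 c00 gap] := signed_pow_gap p1 e0 (addr_ge0 L0 L0).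
have [y My] : exists y, M y.
  apply/set0P/eqP => M00; move: M0; rewrite M00 measure0; by rewrite ltxx.
have rho00 : 0 < rho0.
  by apply: (lt_le_trans r0); have := Mfar y My; have := Mbnd y My; lra.
set c := c0 * (N%:R * (r + rho0)) `^ (- (N%:R + s * p)).
have cp : 0 < c by rewrite mulr_gt0// powR_gt0// mulr_gt0 ?ltr0n// addr_gt0.
have [Crho Crho0 HC] := integral_trunc_kernel (N := N) sp0 spg.
have Mfin : mu M \is a fin_num.
  rewrite ge0_fin_numE//; apply: (@le_lt_trans _ _ (mu [set y | `|x0 - y| <= rho0])).
    by apply: le_measure; rewrite ?inE//; exact: measurable_cube.
  rewrite (lebesgue_cube x0 (ltW rho00)) ltry//.
set mM' := fine (mu M).
have mMp : 0 < mM' by rewrite fine_gt0// M0 ltey_eq Mfin.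
have cost0 : 0 <= C * (Crho + Crho + Q).
  exact: mulr_ge0 C0 (addr_ge0 (addr_ge0 Crho0 Crho0) Q0).
have gain0 : 0 < c * (mM' + mM') := mulr_gt0 cp (addr_gt0 mMp mMp).
have [a [a0 a1 ae aK]] := small_power th0 cost0 gain0 (addr_gt0 e0 e0).
set phi := barrier_excess x0 r a v w.
have phi0 x : 0 <= phi x by exact: barrier_excess_ge0.
have mphi : measurable_fun setT phi by exact: measurable_barrier_excess.
have tphi : test_function s p D phi.
  by apply: test_function_barrier_excess => //; exact: ltW.
have iphi : mu.-integrable setT (EFin \o phi).
  by apply: integrable_barrier_excess => //; exact: ltW.
have [iP iQ PQ0] := vw phi tphi.
set E := C * a `^ th.
have E0 : 0 <= E by rewrite mulr_ge0 ?powR_ge0.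
have Ifin := integrable_fin_num measurableT iphi.
pose I := fine (\int[mu]_x (phi x)%:E)%E.
have IE : (\int[mu]_x (phi x)%:E = I%:E)%E by rewrite /I fineK.
have I0 : 0 <= I by rewrite -lee_fin -IE; apply: integral_ge0 => x _; rewrite lee_fin.
pose K z := trunc_kernel (N := N) g (s * p) `|z.1 - z.2|.
have K0 z : 0 <= K z by exact: trunc_kernel_ge0.
have mK : measurable_fun setT K by exact: measurable_trunc_kernelB.
pose B z := K z * (phi z.1 + phi z.2).
pose A z := \1_M z.2 * phi z.1 + \1_M z.1 * phi z.2.
have mphi1 : measurable_fun setT (fun z : rV * rV => phi z.1).
  exact: (measurableT_comp mphi measurable_fst).
have mphi2 : measurable_fun setT (fun z : rV * rV => phi z.2).
  exact: (measurableT_comp mphi measurable_snd).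
have intB : (\int[mu \x mu]_z (B z)%:E <= ((Crho + Crho) * I)%:E)%E.
  have KC x y' : K (x, y') = K (y', x) by rewrite /K/= distrC.
  have := integral_kernel_weight Crho0 mK K0 KC HC mphi phi0.
  by rewrite IE -EFinM.
have iB : (mu \x mu)%E.-integrable setT (EFin \o B).
  apply: ge0_integrable.
  - by apply: measurable_funM => //; exact: measurable_funD.
  - by move=> z; rewrite mulr_ge0// addr_ge0.
  - by apply: le_lt_trans intB _; rewrite ltry.
have intA : (\int[mu \x mu]_z (A z)%:E = ((mM' + mM') * I)%:E)%E.
  have Mfin' : mu M = mM'%:E by rewrite fineK.
  transitivity (mu M * \int[mu]_x (phi x)%:E + mu M * \int[mu]_x (phi x)%:E)%E.
    exact: integral_tensor.
  by rewrite IE Mfin' -!EFinM -EFinD mulrDl.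
have iA : (mu \x mu)%E.-integrable setT (EFin \o A).
  apply: ge0_integrable.
  - apply: measurable_funD; apply: measurable_funM => //.
      exact: (measurableT_comp (measurable_indic mM) measurable_snd).
    exact: (measurableT_comp (measurable_indic mM) measurable_fst).
  - by move=> z; rewrite addr_ge0// mulr_ge0// indicE.
  - by rewrite intA ltry.
have [mS S0] := slab_null mZ Z0.
have iEB := integrableZl measurableT E iB.
have icA := integrableZl measurableT c iA.
have leP : (\int[mu \x mu]_z (form_density s p v w phi z)%:E <=
    (E * ((Crho + Crho) * I) - c * ((mM' + mM') * I))%:E)%E.
  apply: (@le_trans _ _ (\int[mu \x mu]_z (E * B z - c * A z)%:E)%E).
    apply: (ae_le_integral measurableT mS S0) => //.
      by have := integrableB measurableT iEB icA; apply: eq_integrable.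
    move=> [x y'] _ Sxy; apply: (barrier_integrand (L := L) (rho0 := rho0) (Z := Z) (e := e)) => //.
    + exact: Mfar.
    + exact: Mbnd.
    + exact: grow.
    + exact: ltW.
    + by move=> Zx; apply: Sxy; left.
    + by move=> Zy; apply: Sxy; right.
  under eq_integral do rewrite EFinB.
  rewrite (integralB_EFin measurableT iEB icA) EFinB.
  apply: leeB; under eq_integral do rewrite EFinM.
    rewrite integralZl//.
    by rewrite [in leRHS]EFinM; apply: lee_wpmul2l; rewrite ?lee_fin.
  rewrite integralZl//.
  by rewrite intA -EFinM.
have leQ : (\int[mu]_(x in D) (potential_density p q v w phi x)%:E <= (Q * E * I)%:E)%E.
  have iQE := integrableZl measurableT (Q * E) iphi.
  apply: (@le_trans _ _ (\int[mu]_(x in D) (Q * E * phi x)%:E)%E).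
    apply: (ae_le_integral mD mZ Z0) => //.
      by apply: (integrableS measurableT mD) => //; apply: iQE.
    move=> x Dx Zx; rewrite /potential_density.
    have := phi0 x; rewrite le_eqVlt => /predU1P[<-|px]; first by rewrite !mulr0.
    rewrite ler_pM2r//.
    have [|xr vwa] := barrier_excess_gt0 _ (ltW a0) px => //.
    have hvw : 0 <= h (v x) - h (w x) by rewrite subr_ge0 le_signed_pow// wv.
    have hE : h (v x) - h (w x) <= E.
      apply: (@le_trans _ _ (h (w x + a) - h (w x))).
        by rewrite lerD2r; apply: (le_signed_pow p1); lra.
      by rewrite (le_trans (ler_norm _))// pot// ?wL// ltW.
    apply: (@le_trans _ _ (Q * (h (v x) - h (w x)))); first by rewrite ler_wpM2r// qQ.
    exact: ler_wpM2l.
  apply: (@le_trans _ _ (\int[mu]_x (Q * E * phi x)%:E)%E).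
    apply: ge0_subset_integral => //.
      by apply/measurable_EFinP; apply: measurable_funM.
    by move=> x _; rewrite lee_fin; apply: mulr_ge0 => //; exact: mulr_ge0.
  under eq_integral do rewrite EFinM.
  by rewrite integralZl// IE -EFinM.
have I00 : I = 0.
  apply/eqP; rewrite eq_le I0 andbT leNgt; apply/negP => Ip.
  (* the upper bound for the tested inequality is a negative multiple of I *)
  have := le_trans PQ0 (leeD leP leQ); rewrite -EFinD lee_fin leNgt => /negP; apply.
  have -> : E * ((Crho + Crho) * I) - c * ((mM' + mM') * I) + Q * E * I =
    (C * (Crho + Crho + Q) * a `^ th - c * (mM' + mM')) * I by rewrite /E; ring.
  by rewrite nmulr_rlt0// subr_lt0.
have phi_ae : ae_eq mu setT (EFin \o phi) (cst 0%E).
  apply/(ae_eq_integral_abs mu measurableT); first exact/measurable_EFinP.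
  rewrite -[RHS]/(0%:E) -I00 -IE; apply: eq_integral => x _ /=.
  by rewrite ger0_norm.
exists (a / 2); first by rewrite divr_gt0.
have Zae : {ae mu, forall x, ~ Z x} by exists Z; split => // x /= /contrapT.
have pae : {ae mu, forall x, phi x = 0} by apply: filterS phi_ae => x /(_ Logic.I) [].
apply: filterS (filterI pae Zae) => x [px Zx] xr.
have th' := tent_ge_half r0 xr.
have u0 : 0 <= v x - w x by rewrite subr_ge0 wv.
have : a * tent x0 r x - (v x - w x) <= phi x.
  by rewrite /phi/barrier_excess (max_r u0) le_max lexx orbT.
rewrite px subr_le0; apply: le_trans.
by rewrite ler_wpM2l// ltW.
Qed.

End local_comparison.

(** * From one ball to all compact sets *)

Section dichotomy.
Context {R : realType} {N : nat}.
Variables (s p : R) (D : set 'rV[R]_N).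
Hypotheses (N0 : (0 < N)%N) (s0 : 0 < s) (s1 : s < 1) (p1 : 1 < p) (oD : open D).
Local Notation rV := 'rV[R]_N.
Local Notation mu := (rV_lebesgue R N).
Local Notation h := (signed_pow p).
Implicit Types (v w q : rV -> R) (Z : set rV).

Let p0 : 0 < p. Proof. exact: lt_trans ltr01 p1. Qed.
Let mD : measurable D. Proof. exact: measurable_open_rV. Qed.

(** What the two alternatives of the theorem say about w beyond boundedness.  The
    Hoelder bound is stated off a null set, because w is an a.e. class and replacing it by its
    regular representative could destroy Borel measurability. *)
Definition regular_off Z w : Prop :=
  (p <= 2 /\ s * p < p - 1) \/
  (2 <= p /\ exists al : R, [/\ 0 < al, al <= 1, s * p < al * (p - 2) + 1 &
    forall K, compact K -> K `<=` D -> exists2 H : R, 0 <= H &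
      forall x y, K x -> K y -> ~ Z x -> ~ Z y ->
        `|w x - w y| <= H * `|x - y| `^ al]).

Lemma sub_regular_off Z Z' w : Z `<=` Z' -> regular_off Z w -> regular_off Z' w.
Proof.
move=> ZZ' [?|[p2 [al [al0 al1 spal wH]]]]; [by left|right; split => //].
exists al; split => // K Kc KD; have [H H0 HP] := wH K Kc KD; exists H => //.
by move=> x y Kx Ky Zx Zy; apply: HP => // /ZZ'.
Qed.

Lemma regular_offN Z w : regular_off Z w -> regular_off Z (fun x => - w x).
Proof.
move=> [?|[p2 [al [al0 al1 spal wH]]]]; [by left|right; split => //].
exists al; split => // K Kc KD; have [H H0 HP] := wH K Kc KD; exists H => //.
move=> x y Kx Ky Zx Zy; have -> : - w x - - w y = - (w x - w y) by ring.
by rewrite normrN; exact: HP.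
Qed.

Lemma holder_regular_off al w : 2 <= p -> 0 < al -> al <= 1 -> s * p - 1 < al * (p - 2) ->
  holder_loc al D w -> exists Z, [/\ measurable Z, mu Z = 0%E & regular_off Z w].
Proof.
move=> p2 al0 al1 spal [f [Z [mZ Z0 wf]] fH]; exists Z; split => //; right; split => //.
exists al; split => //; first lra.
move=> K Kc KD; have [C HC] := fH K Kc KD.
exists (`|C| * N%:R `^ al); first by rewrite mulr_ge0 ?powR_ge0.
move=> x y Kx Ky Zx Zy.
have wfE z : K z -> ~ Z z -> w z = f z.
  by move=> Kz Zz; apply: contrapT => wz; apply/Zz/wf => /(_ (KD _ Kz)).
rewrite !wfE//; apply: (le_trans (HC x y Kx Ky)).
apply: (@le_trans _ _ (`|C| * enorm (x - y) `^ al)).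
  by apply: ler_wpM2r; rewrite ?powR_ge0 ?ler_norm.
rewrite -mulrA -powRM//; apply: ler_wpM2l => //.
apply: ge0_ler_powR; rewrite ?nnegrE ?(ltW al0) ?sqrtr_ge0 ?mulr_ge0//.
exact: enorm_le_norm.
Qed.

(** The exponent th of a is min(1, p-1). *)
Lemma regular_growth Z w (x0 : rV) (r L : R) : regular_off Z w ->
  0 < r -> 0 <= L -> (forall x, ~ Z x -> `|w x| <= L) ->
  (forall x, `|x0 - x| <= 2 * r -> D x) ->
  exists C g th, [/\ 0 <= C, s * p < g, 0 < th,
    forall (a : R) x y, 0 <= a -> a <= 1 -> ~ Z x -> ~ Z y -> `|x0 - x| <= r ->
      `|h (w x - w y + a * (tent x0 r x - tent x0 r y)) - h (w x - w y)| <=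
      C * a `^ th * Num.min (`|x - y| `^ g) 1 &
    forall a t : R, 0 <= a -> a <= 1 -> `|t| <= L -> `|h (t + a) - h t| <= C * a `^ th].
Proof.
move=> reg r0 L0 wL BD.
have q0 : 0 < p - 1 by rewrite subr_gt0.
case: reg => [[p2 spq]|[p2 [al [al0 al1 spal wH]]]].
  have [C C0 HC] := signed_pow_growth_sublinear p1 w x0 r0 p2.
  exists (C + 2), (p - 1), (p - 1); split => //; first by rewrite addr_ge0.
    move=> a x y a0 a1 _ _ _; apply: (le_trans (HC a x y a0)).
    apply: ler_wpM2r; first by rewrite le_min powR_ge0 ler01.
    by apply: ler_wpM2r; rewrite ?powR_ge0 ?lerDl.
  move=> a t a0 a1 _; apply: (le_trans (signed_pow_le2 p1 _ _ p2)).
  rewrite [t + a]addrC addrK (ger0_norm a0).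
  by apply: ler_wpM2r; rewrite ?powR_ge0 ?lerDr.
have [H H0 HP] := wH _ (@compact_cube R N x0 (2 * r)) BD.
have wH' x y : ~ Z x -> ~ Z y -> `|x0 - x| <= 2 * r -> `|x0 - y| <= 2 * r ->
    `|w x - w y| <= H * `|x - y| `^ al by move=> *; exact: HP.
have [C C0 HC] := signed_pow_growth_hoelder p1 r0 p2 al0 al1 L0 H0 wL wH'.
have [n pn] : exists n : nat, p - 1 <= n%:R.
  exists (Num.truncn (p - 1)).+1; exact/ltW/truncnS_gt.
pose C2 := n%:R * (L + 1) `^ (p - 2).
have C20 : 0 <= C2 by rewrite mulr_ge0 ?powR_ge0.
exists (C + C2), (al * (p - 2) + 1), 1; split => //; first by rewrite addr_ge0.
  move=> a x y a0 a1 Zx Zy xr; apply: (le_trans (HC a x y a0 a1 Zx Zy xr)).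
  rewrite powRr1//; apply: ler_wpM2r; first by rewrite le_min powR_ge0 ler01.
  by apply: ler_wpM2r; rewrite ?lerDl.
move=> a t a0 a1 tL.
have taL : `|t + a| <= L + 1.
  by rewrite (le_trans (ler_normD _ _))// lerD// ger0_norm.
have tL1 : `|t| <= L + 1 by rewrite (le_trans tL)// lerDl.
apply: (le_trans (signed_pow_ge2 p1 p2 pn taL tL1)).
rewrite [t + a]addrC addrK (ger0_norm a0) powRr1//.
by apply: ler_wpM2r; rewrite ?lerDr.
Qed.

(** Up to a null set, the set where v and w differ is the union over n of these
    sets, because a single point is null; so one of them has positive measure.  The
    excluded cube around x0 shrinks with n, so this holds at every point x0 of D. *)
Lemma gap_region v w (x0 : rV) (r1 : R) : 0 < r1 ->
  measurable_fun setT v -> measurable_fun setT w ->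
  {ae mu, forall x, w x <= v x} -> ~ {ae mu, forall x, v x = w x} ->
  exists n : nat, let S := [set y : rV | [/\ n.+1%:R^-1 <= v y - w y,
      2 * (r1 / n.+1%:R) <= `|x0 - y| & `|x0 - y| <= n.+1%:R]] in
    measurable S /\ (0 < mu S)%E.
Proof.
move=> r10 mv mw wv; apply: contra_notP => /forallNP noS.
pose S (n : nat) := [set y : rV | [/\ n.+1%:R^-1 <= v y - w y,
      2 * (r1 / n.+1%:R) <= `|x0 - y| & `|x0 - y| <= n.+1%:R]].
have mS n : measurable (S n).
  have mu_ : measurable_fun setT (fun y => v y - w y) by exact: measurable_funB.
  have md : measurable_fun setT (fun y : rV => `|x0 - y|).
    exact: (measurableT_comp measurable_normB (pair1_measurable x0)).
  have -> : S n = (setT `&` (fun y => v y - w y) @^-1` `[n.+1%:R^-1, +oo[%classic) `&`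
      ((setT `&` (fun y : rV => `|x0 - y|) @^-1` `[2 * (r1 / n.+1%:R), +oo[%classic) `&`
       (setT `&` (fun y : rV => `|x0 - y|) @^-1` `]-oo, n.+1%:R]%classic)).
    apply/seteqP; split => y /=.
      by move=> [a b c]; rewrite !in_itv/= !andbT.
    by rewrite !in_itv/= !andbT => -[[_ a] [[_ b] [_ c]]].
  by apply: measurableI; [exact: mu_|apply: measurableI; exact: md].
have S0 n : mu (S n) = 0%E.
  apply/eqP; rewrite eq_le measure_ge0 andbT leNgt; apply/negP => Sp.
  exact: (noS n (conj (mS n) Sp)).
have [Z [mZ Z0 wvZ]] := wv.
have nullB : mu.-negligible (\bigcup_n S n).
  by apply: negligible_bigcup => n; exists (S n); split; [exact: mS|exact: S0|].
have nullx : mu.-negligible [set x0].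
  have x0E : [set x0] = [set y : rV | `|x0 - y| <= 0].
    apply/seteqP; split => y /= => [->|]; first by rewrite subrr normr0.
    by rewrite normr_le0 subr_eq0 => /eqP.
  exists [set x0]; split => //; last exact: lebesgue_set1.
  by rewrite x0E; exact: measurable_cube.
have nullZ : mu.-negligible Z by exists Z; split => //.
apply: negligibleS (negligibleU nullZ (negligibleU nullx nullB)) => y /= vwy.
have [Zy|Zy] := pselect (Z y); [by left|right].
have [->|x0y] := eqVneq y x0; [by left|right].
have wvy : w y <= v y by apply: contrapT => wvy; apply/Zy/wvZ.
have uy : 0 < v y - w y.
  by rewrite subr_gt0 lt_neqAle wvy andbT; apply/eqP => E; apply: vwy.
have dy : 0 < `|x0 - y| by rewrite normr_gt0 subr_eq0 eq_sym.
(* any n with t < n + 1 satisfies the three conditions that put y in S n *)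
pose t := (v y - w y)^-1 + 2 * r1 / `|x0 - y| + `|x0 - y|.
have t1 : 0 <= (v y - w y)^-1 by rewrite invr_ge0 ltW.
have t2 : 0 <= 2 * r1 / `|x0 - y| by rewrite divr_ge0// mulr_ge0// ltW.
have tn : t < (Num.truncn t).+1%:R by exact: truncnS_gt.
have n0 : 0 < (Num.truncn t).+1%:R :> R by rewrite ltr0n.
exists (Num.truncn t) => //; split.
- rewrite -[leRHS]invrK lef_pV2 ?posrE ?invr_gt0//; apply: ltW; apply: le_lt_trans tn.
  by rewrite /t -addrA lerDl addr_ge0// ltW.
- rewrite mulrA ler_pdivrMr// [leRHS]mulrC -ler_pdivrMr//; apply: ltW; apply: le_lt_trans tn.
  by rewrite /t addrAC lerDr addr_ge0// ltW.
- by apply: ltW; apply: le_lt_trans tn; rewrite /t lerDr addr_ge0.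
Qed.

(** The hypotheses hold off a common null set Y, and gap_region supplies the set M,
    with e = 1/(4(n+1)) and r = r1/(n+1). *)
Lemma local_positivity q v w Z (L : R) :
  measurable Z -> mu Z = 0%E -> regular_off Z w ->
  measurable_fun setT v -> measurable_fun setT w ->
  (nl_energy s p D v < +oo)%E -> (nl_energy s p D w < +oo)%E ->
  Lp_on D +oo%E q -> {ae mu, forall x, `|w x| <= L} ->
  {ae mu, forall x, w x <= v x} ->
  ordered_forms s p D q v w -> ~ {ae mu, forall x, v x = w x} ->
  forall x0, D x0 -> exists rb : R * R, [/\ 0 < rb.1, 0 < rb.2 &
    {ae mu, forall x, `|x0 - x| <= rb.1 -> rb.2 <= v x - w x}].
Proof.
move=> mZ Z0 reg mv mw voo woo qD wL wv vw nvw x0 Dx0.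
have [Q Q0 qQ] := ae_bounded_Lp_on qD.
have [Z1 [mZ1 Z10 wLZ]] := wL; have [Z2 [mZ2 Z20 wvZ]] := wv; have [Z3 [mZ3 Z30 qZ]] := qQ.
pose Y := Z `|` (Z1 `|` (Z2 `|` Z3)).
have mY : measurable Y by do !apply: measurableU.
have Y0 : mu Y = 0%E.
  have nul A : measurable A -> mu A = 0%E -> mu.-negligible A by exists A; split.
  apply/(negligibleP _ mY); apply: negligibleU; first exact: nul.
  by apply: negligibleU; [exact: nul|apply: negligibleU; exact: nul].
have [r1 r10 BD] : exists2 r1, 0 < r1 & forall x, `|x0 - x| <= 2 * r1 -> D x.
  have /nbhs_ballP[e /= e0 eD] : nbhs x0 D by exact: open_nbhs_nbhs.
  exists (e / 4); first by rewrite divr_gt0.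
  move=> x xe; apply: eD; rewrite -ball_normE/=; apply: (le_lt_trans xe); lra.
have [n [mS S0]] := gap_region x0 r10 mv mw wv nvw.
set S := [set _ | _] in mS S0.
have n0 : 0 < n.+1%:R :> R by rewrite ltr0n.
pose r := r1 / n.+1%:R.
have r0 : 0 < r by rewrite divr_gt0.
have rr1 : r <= r1 by rewrite ler_pdivrMr// ler_peMr ?ler1n// ltW.
pose L' := `|L|; have L0 : 0 <= L' by exact: normr_ge0.
have wL' x : ~ Y x -> `|w x| <= L'.
  move=> Yx; apply: le_trans (ler_norm L); apply: contrapT => wx.
  by apply: Yx; right; left; apply: wLZ.
have BD2 x : `|x0 - x| <= 2 * r -> D x.
  by move=> xr; apply: BD; apply: (le_trans xr); rewrite ler_pM2l.
have regY : regular_off Y w by apply: sub_regular_off reg => x; left.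
have [C [g [th [C0 spg th0 grow pot]]]] := regular_growth regY r0 L0 wL' BD2.
have e0 : 0 < n.+1%:R^-1 / 4 :> R by rewrite divr_gt0 ?invr_gt0.
have [b b0 bP] : exists2 b, 0 < b &
    {ae mu, forall x, `|x0 - x| <= r / 2 -> b <= v x - w x}.
  apply: (@strong_comparison_ball R N s p D s0 s1 p1 mD v w q x0 r L'
    (n.+1%:R^-1 / 4) C g th n.+1%:R Q Y S) => //.
  - by move=> x xr; apply: BD2; rewrite (le_trans xr)//; lra.
  - by move=> x Yx; apply: contrapT => wx; apply: Yx; right; right; left; apply: wvZ.
  - move=> x Yx Dx; apply: le_trans (ler_norm _) _; apply: contrapT => qx.
    by apply: Yx; do 3! right; apply: qZ => /(_ Dx).
  - by move=> y [].
  - by move=> y [].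
  - by move=> y [yS _ _] _; rewrite mulrC divfK.
exists (r / 2, b); split => //=; by rewrite divr_gt0.
Qed.

Lemma nl_energyN (u : rV -> R) : nl_energy s p D (fun x => - u x) = nl_energy s p D u.
Proof.
apply: eq_integral => z _; congr (_ `^ _ / _)%:E.
by rewrite -opprD normrN.
Qed.

(** Apply local_positivity to the pair (-w, -v). *)
Lemma local_positivity_upper q v w Z (L : R) :
  measurable Z -> mu Z = 0%E -> regular_off Z v ->
  measurable_fun setT v -> measurable_fun setT w ->
  (nl_energy s p D v < +oo)%E -> (nl_energy s p D w < +oo)%E ->
  Lp_on D +oo%E q -> {ae mu, forall x, `|v x| <= L} ->
  {ae mu, forall x, w x <= v x} ->
  ordered_forms s p D q v w -> ~ {ae mu, forall x, v x = w x} ->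
  forall x0, D x0 -> exists rb : R * R, [/\ 0 < rb.1, 0 < rb.2 &
    {ae mu, forall x, `|x0 - x| <= rb.1 -> rb.2 <= v x - w x}].
Proof.
move=> mZ Z0 reg mv mw voo woo qD vL wv vw nvw x0 Dx0.
pose v' x := - w x; pose w' x := - v x.
have mv' : measurable_fun setT v' by exact: (measurableT_comp (@oppr_measurable R setT) mw).
have mw' : measurable_fun setT w' by exact: (measurableT_comp (@oppr_measurable R setT) mv).
have voo' : (nl_energy s p D v' < +oo)%E by rewrite nl_energyN.
have woo' : (nl_energy s p D w' < +oo)%E by rewrite nl_energyN.
have wL' : {ae mu, forall x, `|w' x| <= L}.
  by apply: filterS vL => x; rewrite normrN.
have wv' : {ae mu, forall x, w' x <= v' x}.
  by apply: filterS wv => x; rewrite lerN2.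
have nvw' : ~ {ae mu, forall x, v' x = w' x}.
  by move=> E; apply: nvw; apply: filterS E => x /oppr_inj.
have [rb [r0 b0 rbP]] := local_positivity mZ Z0 (regular_offN reg) mv' mw' voo' woo'
  qD wL' wv' (ordered_formsN vw) nvw' Dx0.
exists rb; split => //; apply: filterS rbP => x H /H.
by rewrite /v' /w' opprK addrC.
Qed.

(** A finite subcover of the closure of K by balls reduces this to a minimum of
    finitely many positive bounds; the finite union of exceptional null sets is null. *)
Lemma ess_inf_on_gt0 (u : rV -> R) :
  (forall x0, D x0 -> exists rb : R * R, [/\ 0 < rb.1, 0 < rb.2 &
    {ae mu, forall x, `|x0 - x| <= rb.1 -> rb.2 <= u x}]) ->
  forall K, compactly_contained K D -> (0 < ess_inf_on K u)%E.
Proof.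
move=> loc K [Kc KD].
have /choice[rb rbP] : forall x0, exists rb : R * R, D x0 -> [/\ 0 < rb.1, 0 < rb.2 &
    {ae mu, forall x, `|x0 - x| <= rb.1 -> rb.2 <= u x}].
  move=> x0; have [Dx0|nDx0] := pselect (D x0); last by exists (0, 0).
  by have [rb] := loc x0 Dx0; exists rb.
have key (t : seq rV) : (forall x, x \in t -> D x) -> exists2 b, 0 < b &
    {ae mu, forall y, (exists2 x, x \in t & `|x - y| <= (rb x).1) -> b <= u y}.
  elim: t => [_|x t IH tD]; first by exists 1 => //; apply: aeW => y [].
  have [b b0 bP] := IH (fun y yt => tD y (mem_behead (s := x :: t) yt)).
  have [_ b'0 b'P] := rbP x (tD x (mem_head _ _)).
  exists (Num.min b (rb x).2); first by rewrite lt_min b0.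
  apply: filterS (filterI bP b'P) => y [by_ b'y] [x'].
  rewrite inE => /orP[/eqP ->|x't] yr; rewrite ge_min.
    by rewrite (b'y yr) orbT.
  by rewrite by_//; exists x'.
move: Kc; rewrite compact_cover => /(_ rV (closure K) (fun x => ball x (rb x).1)).
case.
- by move=> x _; exact: ball_open.
- move=> x Kx; exists x => //; apply: ballxx; by have [] := rbP x (KD _ Kx).
move=> F FK KF; have [b b0 bP] : exists2 b, 0 < b &
    {ae mu, forall y, (exists2 x, x \in finmap.enum_fset F & `|x - y| <= (rb x).1) -> b <= u y}.
  by apply: key => x xF; apply: KD; have := FK x xF; rewrite inE.
apply: (@lt_le_trans _ _ b%:E); first by rewrite lte_fin.
apply/ess_infP; apply: filterS bP => y yb /=.
rewrite /patch; case: ifPn => [|_]; last by rewrite leey.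
rewrite inE => Ky /=; rewrite lee_fin; apply: yb.
have [x xF] := KF y (subset_closure Ky).
by rewrite -ball_normE/= => xy; exists x => //; exact: ltW.
Qed.

End dichotomy.

(** * The strong comparison principle *)

Theorem theorem1p1 (R : realType) (N : nat) (s p : R) (D : set 'rV[R]_N)
    (q g v w : 'rV[R]_N -> R) :
  (1 <= N)%N -> 0 < s -> s < 1 -> 1 < p ->
  open D ->
  Lp_on D +oo%E q ->
  {ae rV_lebesgue R N, forall x, D x -> 0 <= q x} ->
  Lp_on D (p / (p - 1))%:E g ->
  fracWtilde s p D v -> fracWtilde s p D w ->
  supersolution s p D q g v ->
  subsolution s p D q g w ->
  {ae rV_lebesgue R N, forall x, w x <= v x} ->
  [\/ [/\ 1 / (1 - s) < p, p <= 2 &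
        Lp_on setT +oo%E v \/ Lp_on setT +oo%E w]
    | 2 <= p /\ exists alpha : R,
        [/\ 0 < alpha, alpha <= 1, s * p - 1 < alpha * (p - 2) &
          (holder_loc alpha D v /\ Lp_on setT +oo%E v) \/
          (holder_loc alpha D w /\ Lp_on setT +oo%E w)]] ->
  {ae rV_lebesgue R N, forall x, v x = w x} \/
  (forall K : set 'rV[R]_N, compactly_contained K D ->
    (0 < ess_inf_on K (v \- w)%R)%E).
Proof.
move=> N0 s0 s1 p1 oD qD _ _ [vl voo] [wl woo] vsup wsub wv alt.
have mD : measurable D := measurable_open_rV oD.
have mv := measurable_Lp_loc vl; have mw := measurable_Lp_loc wl.
have vw := ordered_forms_sol p1 mD qD vsup wsub.
have [|nvw] := pselect {ae rV_lebesgue R N, forall x, v x = w x}; [by left|right].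
apply: (ess_inf_on_gt0 (D := D)) => //.
suff : (exists Z, [/\ measurable Z, rV_lebesgue R N Z = 0%E, regular_off s p D Z v &
      Lp_on setT +oo%E v]) \/
    (exists Z, [/\ measurable Z, rV_lebesgue R N Z = 0%E, regular_off s p D Z w &
      Lp_on setT +oo%E w]).
  move=> [] [Z [mZ Z0 reg /ae_bounded_Lp_on[L _ uL]]] x0 Dx0; last first.
    apply: (local_positivity N0 s0 s1 p1 oD mZ Z0 reg mv mw voo woo qD _ wv vw nvw Dx0).
    by apply: filterS uL => x; apply.
  apply: (local_positivity_upper N0 s0 s1 p1 oD mZ Z0 reg mv mw voo woo qD _ wv vw nvw Dx0).
  by apply: filterS uL => x; apply.
case: alt => [[sp p2 vw_oo]|[p2 [al [al0 al1 spal vw_reg]]]].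
  have spq : s * p < p - 1.
    by move: sp; rewrite ltr_pdivrMr ?subr_gt0// mulrBr mulr1; lra.
  by case: vw_oo => oo; [left|right]; exists set0; split => //;
    rewrite ?measure0//; left.
by case: vw_reg => -[reg oo]; [left|right];
  have [Z [mZ Z0 rZ]] := holder_regular_off p2 al0 al1 spal reg; exists Z; split.
Qed.
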